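(* Let $X=(X,d)$ be an ultrametric Polish space whose diameter is not nontrivially unbounded. Then the $\mathsf{Lip}(d)$-hierarchy on the Borel subsets of $X$ is very good.
   Context: Work in ZF + DC($\mathbb{R}$). An ultrametric Polish space is a separable metric space $(X,d)$ with $d$ a complete ultrametric. A point $x$ is $\varepsilon$-isolated if $\{y:d(x,y)<\varepsilon\}=\{x\}$. The diameter of $X$ is nontrivially unbounded if for every $k\in\omega$ and every $\varepsilon>0$ there are $x,y\in X$ with $d(x,y)>k$ such that neither is $\varepsilon$-isolated. $\mathsf{Lip}(d)$ is the set of self-maps of $X$ Lipschitz with some constant. $A\le_{\mathsf{Lip}(d)}B$ iff $A=f^{-1}(B)$ for some $f\in\mathsf{Lip}(d)$; $A<B$ means $A\le B$ and $B\not\le A$; $\neg A=X\setminus A$. The hierarchy on Borel sets is very good if (i) for all Borel $A,B$, $A\le B$ or $\neg B\le A$, and (ii) there is no sequence of Borel sets with $A_{n+1}<A_n$ for all $n$. *)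

(* Defs.v *)
From HB Require Import structures.
From mathcomp Require Import all_boot all_order all_algebra.
From mathcomp Require Import all_classical all_reals all_analysis.

Set Implicit Arguments.
Unset Strict Implicit.
Unset Printing Implicit Defensive.

Import Order.TTheory GRing.Theory Num.Theory.
Import numFieldNormedType.Exports.

Local Open Scope classical_set_scope.
Local Open Scope ring_scope.

Definition ultrametric (R : realType) (X : metricType R) : Prop :=
  forall x y z : X, mdist x z <= Num.max (mdist x y) (mdist y z).

Definition separable_space (T : topologicalType) : Prop :=
  exists2 D : set T, countable D & dense D.

(* The library's [completeType] and [cvg] ask for a pointed type, hence an
   explicit limit point; the empty space is allowed. *)
Definition complete_metric (R : realType) (X : metricType R) : Prop :=
  forall u : nat -> X, cauchy (u @ \oo) -> exists x : X, u @ \oo --> x.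

Definition ultrametric_Polish (R : realType) (X : metricType R) : Prop :=
  [/\ separable_space X, complete_metric X & ultrametric X].

Definition eps_isolated (R : realType) (X : metricType R) (e : R) (x : X) :
    Prop :=
  [set y : X | mdist x y < e] = [set x].

Definition nontrivially_unbounded (R : realType) (X : metricType R) : Prop :=
  forall (k : nat) (e : R), 0 < e ->
    exists x y : X,
      [/\ k%:R < mdist x y, ~ eps_isolated e x & ~ eps_isolated e y].

Definition Lip (R : realType) (X : metricType R) : set (X -> X) :=
  [set f | exists2 L : R, 0 <= L &
    forall x y : X, mdist (f x) (f y) <= L * mdist x y].

Definition Borel (T : topologicalType) : set (set T) := <<s @open T >>.

Definition reducible (X : Type) (F : set (X -> X)) (A B : set X) : Prop :=
  exists2 f : X -> X, F f & A = f @^-1` B.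

Definition strictly_reducible (X : Type) (F : set (X -> X)) (A B : set X) :
    Prop :=
  reducible F A B /\ ~ reducible F B A.

Definition very_good (X : Type) (F : set (X -> X)) (G : set (set X)) : Prop :=
  (forall A B : set X, G A -> G B -> reducible F A B \/ reducible F (~` B) A)
  /\ ~ (exists A : nat -> set X,
          (forall n, G (A n)) /\
          (forall n, strictly_reducible F (A n.+1) (A n))).

(* Main.v *)
Require Import Defs.
From mathcomp Require Import all_boot all_order all_algebra.
From mathcomp Require Import all_classical all_reals all_analysis.
From mathcomp Require Import zify.

(* Fix [e] such that the points which are not [e]-isolated form a bounded set.
   Given Borel sets [A] and [B], let two players build points of bounded balls
   containing these points by playing ever closer approximations, the second
   player winning if the first point is in [A] iff the second one is in [B].
   A winning strategy of the second player is a Lipschitz reduction of [A] to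
   [B], since the isolated points left out can be sent anywhere; one of the
   first player reduces the complement of [B] to [A]. So (i) follows from Borel
   determinacy, which is proved by Martin's unraveling method: every Borel game
   is covered by a game with clopen payoff on a larger tree.

   A strictly decreasing sequence [A n] would give winning strategies of the
   first player in the games for [A n] against [A n.+1] and its complement.
   Composing them along a sequence of bits produces a point whose membership
   in [A 0] flips with each single bit, and a Borel set of bit sequences with
   this property contradicts the Baire category theorem. *)

Set Implicit Arguments.
Unset Strict Implicit.
Unset Printing Implicit Defensive.

Local Open Scope classical_set_scope.

(** * Game trees *)

(** Determinacy itself is not visibly inherited by countable unions, so the class followed through
    the Borel hierarchy is that of sets that can be unraveled over every tree. Unions need
    infinitely many coverings in a row; the [i]-th one leaves the levels up to [k + i] unchanged, so
    that each level changes only finitely often and a limit tree exists. Unraveling decorates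
    positions with sets of positions, and limits have threads as positions: hence trees with
    abstract nodes, and possibly several roots, instead of sequences of moves.

    On the metric side, balls of equal radius in an ultrametric space coincide or are disjoint, so
    close points can be given codes with a common beginning, and a strategy turns common beginnings
    into close images. This controls only pairs closer than [e]; pairs further apart are harmless
    because all images lie in one bounded ball. *)

Record tree : Type := Tree {
  node :> Type;
  lev : node -> nat;
  par : node -> node;
  lev_par : forall p, lev (par p) = (lev p).-1;
  par_root : forall p, lev p = 0 -> par p = p;
  pruned : forall p, exists q, lev q = (lev p).+1 /\ par q = p }.
Arguments lev {t}.
Arguments par {t}.

Section Trees.
Variable T : tree.
Implicit Types (p q : T) (x : nat -> T).

Definition child p q := lev q = (lev p).+1 /\ par q = p.

Definition play x := lev (x 0) = 0 /\ forall n, child (x n) (x n.+1).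

Definition strategy (s : T -> T) := forall p, child p (s p).

(* Player [b] moves from the positions whose level has parity [b]. *)
Definition follows (b : bool) (s : T -> T) x :=
  forall n, odd n = b -> x n.+1 = s (x n).

Definition anc n p := iter (lev p - n) par p.

Lemma play_lev x n : play x -> lev (x n) = n.
Proof. by case=> x0 xS; elim: n => // n IHn; rewrite (xS n).1 IHn. Qed.

Lemma lev_anc n p : lev (anc n p) = minn n (lev p).
Proof.
rewrite /anc; suff H k : lev (iter k par p) = lev p - k by rewrite H; lia.
by elim: k => [|k IHk] /=; rewrite ?lev_par; lia.
Qed.

Lemma lev_anc_le n p : lev (anc n p) <= n.
Proof. by rewrite lev_anc geq_minl. Qed.

Lemma anc_id n p : lev p <= n -> anc n p = p.
Proof. by rewrite /anc -subn_eq0 => /eqP ->. Qed.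

Lemma anc_par n p : n < lev p -> anc n (par p) = anc n p.
Proof.
move=> np; rewrite /anc lev_par -iterSr; congr (iter _ par p); lia.
Qed.

Lemma anc_anc n m p : n <= m -> anc n (anc m p) = anc n p.
Proof.
by move=> nm; rewrite {1}/anc lev_anc /anc -iterD; congr (iter _ par p); lia.
Qed.

Lemma anc_minn n m p : anc n (anc m p) = anc (minn n m) p.
Proof.
case: (leqP n m) => nm; first by rewrite anc_anc.
by rewrite anc_id // lev_anc; lia.
Qed.

Lemma par_anc p : par p = anc (lev p).-1 p.
Proof.
case lp : (lev p) => [|n]; first by rewrite par_root // anc_id // lp.
by rewrite -anc_par ?lp //= anc_id // lev_par lp.
Qed.

Lemma anc_play x n m : play x -> n <= m -> anc n (x m) = x n.
Proof.
move=> px; elim: m => [|m IHm].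
  by rewrite leqn0 => /eqP ->; rewrite anc_id // play_lev.
rewrite leq_eqVlt => /predU1P[->|nm]; first by rewrite anc_id // play_lev.
by rewrite -anc_par ?play_lev // (px.2 m).2 IHm.
Qed.

Lemma play_eq x y n m : play x -> play y -> m <= n -> x n = y n -> x m = y m.
Proof. by move=> px py mn e; rewrite -(anc_play px mn) e anc_play. Qed.

Lemma exists_strategy : exists s, strategy s.
Proof. by have [s sP] := choice (@pruned T); exists s. Qed.

Lemma play_through s p : strategy s ->
  exists2 x, play x & x (lev p) = p /\ forall n, lev p <= n -> x n.+1 = s (x n).
Proof.
move=> ss; exists (fun n => if n <= lev p then anc n p else
    iter (n - lev p) s p).
  split=> [|n] /=; first by rewrite lev_anc min0n.
  case: (ltngtP n (lev p)) => np.
  - rewrite /child !lev_anc; split; first by lia.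
    by rewrite /anc (_ : lev p - n = (lev p - n.+1).+1) //; lia.
  - by rewrite subSn ?(ltnW np) //=; exact: ss.
  - by rewrite np subSnn anc_id ?np //; exact: ss.
split=> [|n np]; first by rewrite leqnn anc_id.
rewrite ltnNge np /= subSn //=; congr s.
case: leqP => // pn; have e : n = lev p by lia.
by rewrite e subnn anc_id.
Qed.

End Trees.

Lemma sval_inj (N : Type) (P : N -> Prop) (a b : {t | P t}) :
  sval a = sval b -> a = b.
Proof.
case: a b => a Pa [b Pb] /= ab; subst b; congr exist.
exact: Prop_irrelevance.
Qed.

Lemma nat_least (P : nat -> Prop) : (exists n, P n) ->
  exists n, P n /\ forall m, m < n -> ~ P m.
Proof.
move=> [n Pn]; have h : exists n, `[< P n >] by exists n; apply/asboolP.
case: (ex_minnP h) => m /asboolP Pm mP; exists m; split=> // j jm /asboolP/mP.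
by rewrite leqNgt jm.
Qed.

Definition some_in {T : Type} (x0 : T) (P : set T) : T :=
  if pselect (exists x, P x) is left h then projT1 (cid h) else x0.

Lemma some_inP {T : Type} (x0 : T) (P : set T) :
  (exists x, P x) -> P (some_in x0 P).
Proof. by rewrite /some_in; case: pselect => // h _; case: cid. Qed.

(** * Reachability games *)

Section Tower.
Variables (N : Type) (F : set N -> set N).
Hypothesis F_mono : forall U V, U `<=` V -> F U `<=` F V.

(* The transfinite iterates of [F] from the empty set. *)
Inductive tower : set N -> Prop :=
| tower_next U : tower U -> tower (U `|` F U)
| tower_sup (G : set (set N)) :
    (forall U, G U -> tower U) -> tower (\bigcup_(U in G) U).

Let next U := U `|` F U.

Let next_mono U V : U `<=` V -> next U `<=` next V.
Proof. by move=> UV p [/UV|/(F_mono UV)]; [left|right]. Qed.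

(** The Bourbaki-Witt argument: the hypothesis says that [U] is an extreme element of the tower, and
    the proof of [tower_linear] shows that all elements are extreme. *)
Lemma tower_linear_at U :
  (forall V, tower V -> V `<=` U -> V <> U -> next V `<=` U) ->
  forall V, tower V -> V `<=` U \/ next U `<=` V.
Proof.
move=> exU V; elim=> {V} [V tV [VU|UV]|G tG IH].
- have [<-|VneU] := pselect (V = U); first by right.
  by left; exact: exU.
- by right; apply: subset_trans UV _ => p; left.
- have [[V GV UV]|nG] := pselect (exists2 V, G V & next U `<=` V).
    by right; apply: subset_trans UV _; exact: bigcup_sup.
  left=> p [V GV Vp]; case: (IH V GV) => [/(_ p Vp)//|UV].
  by case: nG; exists V.
Qed.

Lemma tower_linear U V : tower U -> tower V -> V `<=` U \/ next U `<=` V.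
Proof.
move=> tU; apply: tower_linear_at.
elim: tU => {U} [U tU IH|G tG IH] {}V tV VU VneU.
- case: (tower_linear_at IH tV) => [VsU|UV].
    by apply: next_mono.
  by case: VneU; apply/seteqP.
- have [[U GU nUV]|nG] := pselect (exists2 U, G U & ~ (U `<=` V)).
    case: (tower_linear_at (IH U GU) tV) => [VsU|UV].
      apply: (@subset_trans _ U); last exact: bigcup_sup.
      by apply: (IH U GU V tV VsU) => VU'; apply: nUV; rewrite VU'.
    by case: nUV; apply: subset_trans UV => p; left.
  case: VneU; apply/seteqP; split=> // p [U GU Up].
  by apply: contrapT => nVp; apply: nG; exists U => // /(_ _ Up).
Qed.

Definition limit_tower : set N := \bigcup_(U in tower) U.

Lemma tower_limit : tower limit_tower.
Proof. exact: tower_sup. Qed.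

Lemma limit_tower_fix : F limit_tower `<=` limit_tower.
Proof.
by move=> p Fp; exists (next limit_tower); [exact/tower_next/tower_limit|right].
Qed.

Definition before p : set N := \bigcup_(U in [set U | tower U /\ ~ U p]) U.

Lemma tower_before p : tower (before p).
Proof. by apply: tower_sup => U []. Qed.

Lemma before_sub p U : tower U -> ~ U p -> next U p -> before p `<=` U.
Proof.
move=> tU nUp Up q [V [tV nVp] Vq].
by case: (tower_linear tU tV) => [/(_ q Vq)//|/(_ p Up)/nVp].
Qed.

(** Otherwise the next iterate would still omit [p] and so be contained in [before p]; this set
    would then be closed under [F] and contain the whole tower. *)
Lemma F_before p : limit_tower p -> F (before p) p.
Proof.
case=> U tU Up; apply: contrapT => nF.
have nnext : ~ next (before p) p by case=> // -[V [_ nVp] /nVp].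
have {nnext} : (next (before p) `<=` before p).
  move=> q Bq; exists (next (before p)) => //; split=> //.
  exact/tower_next/tower_before.
move=> fixB; suff /(_ p Up) : U `<=` before p by case=> V [].
elim: tU {Up} => [V tV VB|G tG IH].
  by apply: subset_trans fixB; exact: next_mono.
by move=> q [V GV Vq]; exact: IH GV q Vq.
Qed.

End Tower.

Section Attractor.
Variables (T : tree) (b : bool) (D E : set T).

Definition reach_step (U : set T) : set T :=
  [set p | E p \/ if odd (lev p) == b then exists q, [/\ child p q, D q & U q]
                  else forall q, child p q -> U q].

Lemma reach_step_mono U V : U `<=` V -> reach_step U `<=` reach_step V.
Proof.
move=> UV p [Ep|Up]; [by left|right; move: Up]; case: eqP => _.
  by case=> q [pq Dq /UV Vq]; exists q.
by move=> H q /H/UV.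
Qed.

(* The positions from which [b], moving inside [D], can force the play into
   [E]. *)
Definition attractor : set T := limit_tower reach_step.

Lemma attractor_target : E `<=` attractor.
Proof. by move=> p Ep; apply: limit_tower_fix; left. Qed.

Lemma attractor_own p q :
  odd (lev p) = b -> child p q -> D q -> attractor q -> attractor p.
Proof.
move=> pb pq Dq Wq; apply: limit_tower_fix; right; rewrite pb eqxx; by exists q.
Qed.

Lemma attractor_opp p :
  odd (lev p) = ~~ b -> (forall q, child p q -> attractor q) -> attractor p.
Proof.
move=> pb H; apply: limit_tower_fix; right; rewrite pb; by case: b H.
Qed.

(* The strategy moves into [before p], the last iterate not containing [p]; so
   the play goes through smaller and smaller iterates until it reaches [E]. *)
Lemma attractor_strategy : exists w, [/\ strategy w,
  forall p, attractor p -> ~ E p -> odd (lev p) = b ->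
    attractor (w p) /\ D (w p) &
  forall x n, play x -> attractor (x n) ->
    (forall m, n <= m -> odd m = b -> attractor (x m) ->
      (forall j, n <= j <= m -> ~ E (x j)) -> x m.+1 = w (x m)) ->
    exists2 m, n <= m & E (x m) /\ forall j, n <= j <= m -> attractor (x j)].
Proof.
have mono := reach_step_mono.
have /choice[w wP] : forall p, exists q, child p q /\
    (attractor p -> ~ E p -> odd (lev p) = b ->
      before reach_step p q /\ D q).
  move=> p; have [[pW [nE pb]]|nW] :=
      pselect (attractor p /\ ~ E p /\ odd (lev p) = b).
    have [//|] := F_before mono pW; rewrite pb eqxx => -[q [pq Dq Bq]].
    by exists q.
  have [q pq] := pruned p; exists q; split=> // pW nE pb; exfalso; exact: nW.
exists w; split=> [p|p pW nE pb|x n px]; first exact: (wP p).1.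
  have [Bw Dw] := (wP p).2 pW nE pb; split=> //.
  by exists (before reach_step p) => //; exact: tower_before.
case=> U tU; elim: tU n => {U} [U tU IH|G tG IH] n; last first.
  by case=> V GV Vn; exact: IH GV n Vn.
have [Un _|nUn Un xw] := pselect (U (x n)); first exact: IH.
have Wn : attractor (x n) by exists (U `|` reach_step U) => //; exact: tower_next.
have [En|nE] := pselect (E (x n)).
  exists n => //; split=> // j; by rewrite -eqn_leq => /eqP <-.
have USn : U (x n.+1).
  have [bn|bn] := eqVneq (odd n) b.
    rewrite xw //; last by move=> j; rewrite -eqn_leq => /eqP <-.
    have := (wP (x n)).2 Wn nE; rewrite play_lev // => /(_ bn)[+ _].
    exact: before_sub.
  case: Un => // -[//|]; rewrite play_lev // (negPf bn); apply; exact: px.2.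
case: (IH n.+1 USn) => [m nm bm Wm nEj|m nm [Em Wj]].
  apply: xw => //; first exact: ltnW.
  move=> j /andP[nj jm]; move: nj; rewrite leq_eqVlt => /predU1P[<- //|nj].
  by apply: nEj; rewrite nj.
exists m; first exact: ltnW.
split=> // j /andP[]; rewrite leq_eqVlt => /predU1P[<- //|nj jm].
by apply: Wj; rewrite nj.
Qed.

End Attractor.

(** The forcing strategy would lead some play through [p] into the empty set. *)
Lemma attractor_set0 (T : tree) b (D : set T) : attractor b D set0 `<=` set0.
Proof.
move=> p Wp; have [w [sw _ H]] := attractor_strategy b D set0.
have [x px [xp xw]] := play_through p sw.
case: (H x (lev p) px); rewrite ?xp //.
  by move=> m pm _ _ _; exact: xw.
by move=> m _ [].
Qed.

(** * Coverings *)

Definition play_open (T : tree) (A : set (nat -> T)) :=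
  forall x, play x -> A x ->
    exists n, forall y, play y -> y n = x n -> A y.

Definition play_clopen (T : tree) (A : set (nat -> T)) :=
  play_open A /\ play_open (~` A).

Definition winning_for (T : tree) (A : set (nat -> T)) (r : T) b (s : T -> T) :=
  forall x, play x -> x 0 = r -> follows b s x -> if b then ~ A x else A x.

Definition determined (T : tree) (A : set (nat -> T)) (r : T) :=
  exists b s, strategy s /\ winning_for A r b s.

(** The Gale-Stewart argument: from outside the attractor the second player can always stay outside,
    whereas by openness every play in [A] enters [E]. *)
Lemma open_determined (T : tree) (A : set (nat -> T)) (r : T) :
  play_open A -> lev r = 0 -> determined A r.
Proof.
move=> oA r0.
pose E := [set p : T | forall y, play y -> y (lev p) = p -> A y].
pose W := attractor false setT E.
have [Wr|nWr] := pselect (W r).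
  have [w [sw _ wP]] := attractor_strategy false setT E.
  exists false, w; split=> // x px x0 fx.
  have [||m _ [Em _]] := wP x 0 px; first by rewrite x0.
    by move=> m _ bm _ _; exact: fx.
  by apply: Em => //; rewrite play_lev.
have /choice[s sP] : forall p, exists q, child p q /\
    (~ W p -> odd (lev p) = true -> ~ W q).
  move=> p; have [[nW op]|H] := pselect (~ W p /\ odd (lev p) = true).
    apply: contrapT => H; apply: nW; apply: attractor_opp => // q pq.
    by apply: contrapT => nWq; apply: H; exists q.
  have [q pq] := pruned p; exists q; split=> // nW op; exfalso; exact: H.
exists true, s; split=> [p|x px x0 fx Ax]; first exact: (sP p).1.
have nW n : ~ W (x n).
  elim: n => [|n IHn]; first by rewrite x0.
  case on : (odd n).
    by rewrite fx //; apply: (sP _).2 => //; rewrite play_lev.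
  apply: contra_not IHn; apply: attractor_own => //; first by rewrite play_lev.
  exact: px.2.
have [n nA] := oA x px Ax; apply: (nW n); apply: attractor_target => y py.
by rewrite play_lev //; exact: nA.
Qed.

Record tree_map (T' T : tree) := TreeMap {
  tmap :> T' -> T;
  lev_tmap : forall p, lev (tmap p) = lev p;
  par_tmap : forall p, tmap (par p) = par (tmap p) }.

Section TreeMaps.
Variables (T2 T1 T0 : tree).

Lemma child_tmap (f : tree_map T1 T0) p q : child p q -> child (f p) (f q).
Proof. by case=> lq pq; split; rewrite ?lev_tmap // -par_tmap pq. Qed.

Lemma play_tmap (f : tree_map T1 T0) x : play x -> play (f \o x).
Proof.
move=> [x0 xS]; split=> [|n] /=; first by rewrite lev_tmap.
exact: child_tmap.
Qed.

Lemma play_open_tmap (f : tree_map T1 T0) (A : set (nat -> T0)) :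
  play_open A -> play_open [set x | A (f \o x)].
Proof.
move=> oA x px Ax; have [n nA] := oA _ (play_tmap f px) Ax.
by exists n => y py yx; apply: nA; [exact: play_tmap|rewrite /= yx].
Qed.

Lemma play_clopen_tmap (f : tree_map T1 T0) (A : set (nat -> T0)) :
  play_clopen A -> play_clopen [set x | A (f \o x)].
Proof.
case=> oA oC; split; first exact: play_open_tmap.
by apply: (play_open_tmap (f := f) oC).
Qed.

Program Definition tmap_comp (f : tree_map T1 T0) (g : tree_map T2 T1) :
  tree_map T2 T0 := @TreeMap T2 T0 (f \o g) _ _.
Next Obligation. by move=> f g p /=; rewrite !lev_tmap. Qed.
Next Obligation. by move=> f g p /=; rewrite !par_tmap. Qed.

Program Definition tmap_id : tree_map T0 T0 := @TreeMap T0 T0 id _ _.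
Next Obligation. by []. Qed.
Next Obligation. by []. Qed.

End TreeMaps.

(* Martin's coverings. A strategy here also carries irrelevant values at the
   positions of the opponent, so [cstr_low] and [cstr_local] speak of all
   positions. *)
Record covering (k : nat) (T' T : tree) := Covering {
  cmap :> tree_map T' T;
  cstr : bool -> (T' -> T') -> T -> T;
  cmap_inj : forall p q, lev p <= k -> cmap p = cmap q -> p = q;
  cmap_surj : forall p, lev p <= k -> exists q, cmap q = p;
  cstr_strategy : forall b s, strategy s -> strategy (cstr b s);
  cstr_local : forall b s s' n, strategy s -> strategy s' ->
    (forall p, lev p <= n -> s p = s' p) ->
    forall p, lev p <= n -> cstr b s p = cstr b s' p;
  cstr_low : forall b s p, strategy s -> lev p < k ->
    cstr b s (cmap p) = cmap (s p);
  cstr_lift : forall b s x, strategy s -> play x -> follows b (cstr b s) x ->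
    exists2 x', play x' /\ follows b s x' & cmap \o x' = x }.

Lemma covering_determined (k : nat) (T' T : tree) (c : covering k T' T)
    (A : set (nat -> T)) (r : T) :
  play_clopen [set x | A (c \o x)] -> lev r = 0 -> determined A r.
Proof.
move=> [oA _] r0; have [|r' rr'] := @cmap_surj _ _ _ c r; first by rewrite r0.
have r'0 : lev r' = 0 by rewrite -(lev_tmap c) rr'.
have [b [s [ss sW]]] := open_determined oA r'0.
exists b, (cstr c b s); split; first exact: cstr_strategy.
move=> x px x0 fx; have [x' [px' fx'] xx'] := cstr_lift ss px fx.
have /(sW x' px') : x' 0 = r'.
  apply: (@cmap_inj _ _ _ c); first by rewrite play_lev.
  by rewrite rr' -x0 -xx'.
by move=> /(_ fx') /=; rewrite xx'.
Qed.

Program Definition covering_comp (k : nat) (T2 T1 T0 : tree)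
    (c : covering k T1 T0) (d : covering k T2 T1) : covering k T2 T0 :=
  @Covering k T2 T0 (tmap_comp c d) (fun b s => cstr c b (cstr d b s))
    _ _ _ _ _ _.
Next Obligation.
move=> k T2 T1 T0 c d p q pk /= e; apply: (@cmap_inj _ _ _ d) => //.
by apply: (@cmap_inj _ _ _ c) => //; rewrite lev_tmap.
Qed.
Next Obligation.
move=> k T2 T1 T0 c d p pk; have [q qp] := cmap_surj c pk.
have [|q' q'q] := @cmap_surj _ _ _ d q; first by rewrite -(lev_tmap c) qp.
by exists q'; rewrite /= q'q qp.
Qed.
Next Obligation.
by move=> k T2 T1 T0 c d b s ss; do 2 apply: cstr_strategy.
Qed.
Next Obligation.
move=> k T2 T1 T0 c d b s s' n ss ss' e; apply: cstr_local.
- exact: cstr_strategy.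
- exact: cstr_strategy.
- exact: cstr_local.
Qed.
Next Obligation.
move=> k T2 T1 T0 c d b s p ss pk /=.
by rewrite !cstr_low ?lev_tmap //; exact: cstr_strategy.
Qed.
Next Obligation.
move=> k T2 T1 T0 c d b s x ss px fx.
have [x1 [px1 fx1] <-] := cstr_lift (cstr_strategy d b ss) px fx.
have [x2 x2P <-] := cstr_lift ss px1 fx1.
by exists x2.
Qed.

(** * Inverse limits of coverings *)

Lemma thread_up (Q : nat -> Type) (f : forall i, Q i.+1 -> Q i)
    (P : forall i, Q i -> Prop) (p : Q 0) :
  P 0 p -> (forall j q, P j q -> exists q', f j q' = q /\ P j.+1 q') ->
  exists y : forall j, Q j, [/\ y 0 = p, forall j, P j (y j) &
    forall j, f j (y j.+1) = y j].
Proof.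
move=> Pp PS.
have next j (q : {q | P j q}) :
    {q' : {q' | P j.+1 q'} | f j (sval q') = sval q}.
  apply/cid; case: q => q Pq; have [q' [fq' Pq']] := PS _ _ Pq.
  by exists (exist _ q' Pq').
pose y := nat_rect (fun j => {q | P j q}) (exist _ p Pp)
  (fun j q => sval (next j q)).
exists (fun j => sval (y j)); split=> // j; first exact: (svalP (y j)).
exact: (svalP (next j (y j))).
Qed.

(** Components above stage [i] are chosen, those below are images under [f]. The induction shifts
    the whole family by one stage, which avoids casts between stages. *)
Lemma thread_through (Q : nat -> Type) (f : forall i, Q i.+1 -> Q i)
    (P : forall i, Q i -> Prop) (i : nat) (p : Q i) :
  P i p ->
  (forall j q, i <= j -> P j q -> exists q', f j q' = q /\ P j.+1 q') ->
  exists y : forall j, Q j, y i = p /\ forall j, f j (y j.+1) = y j.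
Proof.
elim: i Q f P p => [|i IHi] Q f P p Pp PS.
  have [y [y0 _ fy]] := thread_up Pp (fun j q => @PS j q (leq0n j)).
  by exists y.
have [|y [yi fy]] := IHi (fun j => Q j.+1) (fun j => f j.+1)
  (fun j => P j.+1) p Pp; first by move=> j q ij; exact: PS.
exists (fun j => if j is j'.+1 then y j' else f 0 (y 0)).
by split=> //; case.
Qed.

Section InverseLimit.
Variables (k : nat) (T : nat -> tree).
Variable c : forall i, covering (k + i) (T i.+1) (T i).

Definition thread := {y : forall i, T i | forall i, c i (y i.+1) = y i}.

Implicit Types (y z : thread).

Local Notation at_ y i := (sval y i).

Lemma thread_lev y i : lev (at_ y i) = lev (at_ y 0).
Proof.
by elim: i => // i <-; rewrite -(lev_tmap (c i)) (svalP y i).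
Qed.

(** From stage [i] on, the coverings are injective at this level; the earlier components are images
    of the [i]-th one. *)
Lemma thread_inj y z i : lev (at_ y 0) <= k + i -> at_ y i = at_ z i -> y = z.
Proof.
move=> yk yz.
have up j : at_ y (i + j) = at_ z (i + j).
  elim: j => [|j IHj]; first by rewrite addn0.
  rewrite addnS; apply: (@cmap_inj _ _ _ (c (i + j))).
    by rewrite thread_lev; lia.
  by rewrite (svalP y (i + j)) (svalP z (i + j)).
have down j n : at_ y (n + j) = at_ z (n + j) -> at_ y n = at_ z n.
  elim: j => [|j IHj]; first by rewrite addn0.
  rewrite addnS => e; apply: IHj.
  by rewrite -(svalP y (n + j)) -(svalP z (n + j)) e.
apply/sval_inj/functional_extensionality_dep => n; apply: (down i).
by rewrite addnC up.
Qed.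

Lemma thread_at i (p : T i) : lev p <= k + i -> exists y, at_ y i = p.
Proof.
move=> pk.
have [|j q ij /= qk|y [yi yP]] := @thread_through _ (fun i => c i)
  (fun j q => lev q = lev p) i p; first by [].
  have [|q' q'q] := @cmap_surj _ _ _ (c j) q; first by rewrite qk; lia.
  by exists q'; split=> //; rewrite -(lev_tmap (c j)) q'q.
by exists (exist _ y yP).
Qed.

Program Definition limit_tree : tree :=
  @Tree thread (fun y => lev (at_ y 0))
    (fun y => exist _ (fun i => par (at_ y i)) _) _ _ _.
Next Obligation. by move=> y i; rewrite par_tmap (svalP y i). Qed.
Next Obligation. by move=> y /=; rewrite lev_par. Qed.
Next Obligation.
by move=> y y0; apply: (@thread_inj _ _ 0) => /=; rewrite ?lev_par ?y0 // par_root.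
Qed.
Next Obligation.
move=> y; set i := (lev (at_ y 0)).+1.
have [q [lq pq]] := pruned (at_ y i).
have [|z zq] := @thread_at i q; first by rewrite lq thread_lev /i; lia.
exists z; have lz : lev (at_ z 0) = (lev (at_ y 0)).+1.
  by rewrite -(thread_lev z i) zq lq thread_lev.
split=> //; apply: (@thread_inj _ _ i) => /=.
  by rewrite lev_par lz /i; lia.
by rewrite zq pq.
Qed.

Program Definition limit_proj i : tree_map limit_tree (T i) :=
  @TreeMap limit_tree (T i) (fun y => at_ y i) _ _.
Next Obligation. by move=> i y; exact: thread_lev. Qed.
Next Obligation. by []. Qed.

Section Strategies.
Variables (b : bool) (s : limit_tree -> limit_tree).
Hypothesis ss : strategy s.

Definition default_strategy i := sval (cid (exists_strategy (T i))).

Definition push_strategy i (p : T i) : T i :=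
  if pselect (exists y : limit_tree, at_ y i = p /\ lev p < k + i) is left h
  then limit_proj i (s (sval (cid h))) else default_strategy p.

Lemma push_strategyE i (y : limit_tree) :
  lev y < k + i -> push_strategy (limit_proj i y) = limit_proj i (s y).
Proof.
move=> yk; rewrite /push_strategy; case: pselect => [h|[]]; last first.
  by exists y; rewrite lev_tmap.
case: cid => z /= [zy _]; congr (at_ (s _) i).
apply: (@thread_inj _ _ i) => //.
by rewrite -(thread_lev z i) zy thread_lev ltnW.
Qed.

Lemma push_strategyP i : strategy (@push_strategy i).
Proof.
move=> p; rewrite /push_strategy; case: pselect => [h|_].
  by case: cid => z /= [<- _]; apply: (child_tmap (limit_proj i)); exact: ss.
by rewrite /default_strategy; case: cid.
Qed.

(* [push_strategy i] is meaningful only below level [k + i]; pulling it down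
   from stage [i + d] settles the strategy on [T i] below level [k + i + d]. *)
Fixpoint approx d i : T i -> T i :=
  if d is d'.+1 then cstr (c i) b (@approx d' i.+1) else @push_strategy i.

Lemma approxP d i : strategy (@approx d i).
Proof.
by elim: d i => [|d IHd] i; [exact: push_strategyP|exact: cstr_strategy].
Qed.

(** For [d = 0] this is [cstr_low], the covering from stage [i.+1] being trivial below level
    [k + i]; [cstr_local] carries the agreement down the other stages. *)
Lemma approx_step d i (p : T i) : lev p < k + i + d ->
  @approx d.+1 i p = @approx d i p.
Proof.
elim: d i p => [|d IHd] i p pk.
  rewrite addn0 in pk; have [|y yp] := @thread_at i p; first exact: ltnW.
  have yk : lev (y : limit_tree) < k + i.
    by rewrite -(lev_tmap (limit_proj i)) /= yp.
  rewrite -yp.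
  rewrite -[LHS]/(cstr (c i) b (@push_strategy i.+1) (at_ y i)).
  rewrite -[RHS]/(push_strategy (limit_proj i y)).
  rewrite -{1}(svalP y i) cstr_low; last 2 first.
  - exact: push_strategyP.
  - by rewrite thread_lev.
  rewrite push_strategyE //.
  rewrite -[at_ y i.+1]/(limit_proj i.+1 y) push_strategyE ?addnS 1?ltnW //.
  exact: (svalP (s y) i).
apply: (@cstr_local _ _ _ (c i) b (@approx d.+1 i.+1) (@approx d i.+1)
  (lev p)) => //; first exact: approxP.
- exact: approxP.
- by move=> q qp; apply: IHd; lia.
Qed.

Lemma approx_stable d d' i (p : T i) : lev p < k + i + d -> d <= d' ->
  @approx d' i p = @approx d i p.
Proof.
move=> pk; elim: d' => [|d' IHd']; first by rewrite leqn0 => /eqP ->.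
rewrite leq_eqVlt => /predU1P[->//|dd']; rewrite -IHd' //.
by apply: approx_step; lia.
Qed.

(** The depth [(lev p).+1] lies past the point of stabilization whatever [k] and [i] are. *)
Definition limit_strategy i (p : T i) : T i := @approx (lev p).+1 i p.

Lemma limit_strategyP i : strategy (@limit_strategy i).
Proof. by move=> p; exact: approxP. Qed.

Lemma limit_strategy_low i (y : limit_tree) : lev y < k + i ->
  limit_strategy (limit_proj i y) = limit_proj i (s y).
Proof.
move=> yk; rewrite /limit_strategy (@approx_stable 0) //.
  exact: push_strategyE.
by rewrite lev_tmap; lia.
Qed.

(** This compatibility of consecutive stages allows a play against the strategy at stage 0 to be
    lifted one stage after another. *)
Lemma limit_strategyE i (p : T i) :
  limit_strategy p = cstr (c i) b (@limit_strategy i.+1) p.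
Proof.
rewrite /limit_strategy.
rewrite -(@approx_stable _ (lev p).+2) //; last by lia.
apply: (@cstr_local _ _ _ (c i) b (@approx (lev p).+1 i.+1)
  (@limit_strategy i.+1) (lev p)) => //; first exact: approxP.
- exact: limit_strategyP.
by move=> q qp; apply: approx_stable; lia.
Qed.

End Strategies.

Lemma limit_strategy_local b s s' n : strategy s -> strategy s' ->
  (forall p : limit_tree, lev p <= n -> s p = s' p) ->
  forall i (p : T i), lev p <= n ->
    limit_strategy b s p = limit_strategy b s' p.
Proof.
move=> ss ss' e; suff H d i (p : T i) : lev p <= n ->
    approx b s d p = approx b s' d p by move=> i p; exact: H.
elim: d i p => [|d IHd] i p pn.
  rewrite /= /push_strategy; case: pselect => // h.
  case: cid => y /= [yp _]; rewrite e //.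
  by rewrite -(lev_tmap (limit_proj i)) /= yp.
apply: (@cstr_local _ _ _ (c i) b (@approx b s d i.+1)
  (@approx b s' d i.+1) n) => //; first exact: approxP.
- exact: approxP.
- by move=> q; exact: IHd.
Qed.

Program Definition limit_covering : covering k limit_tree (T 0) :=
  @Covering k limit_tree (T 0) (limit_proj 0)
    (fun b s => @limit_strategy b s 0) _ _ _ _ _ _.
Next Obligation.
by move=> y z yk; apply: thread_inj; rewrite addn0.
Qed.
Next Obligation. by move=> p pk; apply: thread_at; rewrite addn0. Qed.
Next Obligation. by move=> b s ss; exact: limit_strategyP. Qed.
Next Obligation.
by move=> b s s' n ss ss' e p pn; exact: (limit_strategy_local b ss ss' e pn).
Qed.
Next Obligation.
by move=> b s p ss pk; apply: (limit_strategy_low b ss (i := 0)); rewrite addn0.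
Qed.
Next Obligation.
move=> b s x ss px fx.
(* Whole plays are lifted through all stages; their positions of a given level then form a
   thread. *)
have [|j q [pq fq]|y [y0 yP yS]] := @thread_up (fun i => nat -> T i)
  (fun i q => c i \o q)
  (fun i q => play q /\ follows b (@limit_strategy b s i) q) x; first by [].
  have [||q' q'P q'q] := @cstr_lift _ _ _ (c j) b
    (@limit_strategy b s j.+1) q _ pq.
  - exact: limit_strategyP.
  - by move=> n bn; rewrite fq // limit_strategyE.
  by exists q'.
have XP n i : c i (y i.+1 n) = y i n by rewrite -(yS i).
pose X n : limit_tree := exist _ (fun i => y i n) (XP n).
have pX : play X.
  split=> [|n]; first exact: (yP 0).1.1.
  have H i := (yP i).1.2 n.
  split; first exact: (H 0).1.
  apply: (@thread_inj _ _ n) => /=; last exact: (H n).2.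
  by rewrite lev_par (play_lev _ (yP 0).1); lia.
exists X; last by apply/funext => n /=; rewrite y0.
split=> // n bn; apply: (@thread_inj _ _ n.+1).
  by rewrite /= (play_lev _ (yP 0).1); lia.
(* At stage [n.+1] the level [n] is low enough for [limit_strategy] to be the projection of [s]. *)
change (y n.+1 n.+1 = limit_proj n.+1 (s (X n))).
rewrite -(@limit_strategy_low b) //.
  by rewrite (yP n.+1).2.
by rewrite (play_lev _ pX); lia.
Qed.

End InverseLimit.

(** * Unraveling a closed set *)

Section Unravel.
Variables (T : tree) (A : set (nat -> T)) (K : nat).
Hypothesis evenK : ~~ odd K.

(** When the complement of [A] is open, a play is outside [A] iff it passes through an exit. *)
Definition exit : set T := [set p | forall x, play x -> x (lev p) = p -> ~ A x].

(* At level [K] the first player announces a set [S] of exits from [A] which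
   will not be reached; [winII S] is where the second player can refute this. *)
Definition winII (S : set T) : set T := attractor true setT S.

(* Where the first player can leave [A] while keeping the promise [S]. *)
Definition winI (S : set T) : set T := attractor false (~` winII S) exit.

(* At level [K.+1] the second player either names an exit [u] compatible with
   the promise, through which the play must then pass ([Some u]), or undertakes
   to stay in [A] forever ([None]). *)
Definition legal_option (p : T) (S : set T) (o : option T) :=
  if o is Some u then
    [/\ K.+1 < lev u, exit u, anc (lev u) p = anc (lev p) u &
        forall m, K < m <= lev u -> ~ winII S (anc m u)]
  else forall m, K.+1 < m <= lev p -> ~ winII S (anc m p) /\ ~ winI S (anc m p).

(** [S] is announced along with the move to level [K.+1], which must leave [winII S]: otherwise the
    second player might have no legal option. *)
Definition legal (p : T) (S : set T) (o : option T) :=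
  (K < lev p -> ~ winII S (anc K.+1 p)) /\ (K.+1 < lev p -> legal_option p S o).

(* Announcements not yet made are replaced by default values. *)
Definition normal (p : T) (S : set T) (o : option T) : T * set T * option T :=
  (p, if lev p <= K then set0 else S, if lev p <= K.+1 then None else o).

Definition unode := {t : T * set T * option T |
  t = normal t.1.1 t.1.2 t.2 /\ legal t.1.1 t.1.2 t.2}.

Definition upos (t : unode) : T := (sval t).1.1.
Definition uset (t : unode) : set T := (sval t).1.2.
Definition uopt (t : unode) : option T := (sval t).2.

Lemma ulegal t : legal (upos t) (uset t) (uopt t).
Proof. exact: (svalP t).2. Qed.

Lemma legal_normal p S o : legal p S o ->
  let t := normal p S o in t = normal t.1.1 t.1.2 t.2 /\ legal t.1.1 t.1.2 t.2.
Proof.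
rewrite /normal /= => -[H1 H2]; split.
  by case: (lev p <= K); case: (lev p <= K.+1).
split=> [pK|pK].
  by rewrite leqNgt pK /=; exact: H1.
by rewrite leqNgt (ltnW pK) /= leqNgt pK /=; exact: H2.
Qed.

Definition mkunode p S o (h : legal p S o) : unode := exist _ _ (legal_normal h).

Lemma unode_eq p S o (h : legal p S o) t : upos t = p ->
  (K < lev p -> uset t = S) -> (K.+1 < lev p -> uopt t = o) -> t = mkunode h.
Proof.
move=> pt St ot; apply: sval_inj => /=; have [-> _] := svalP t.
rewrite /normal; move: pt St ot; rewrite /upos /uset /uopt => -> St ot.
case: (leqP (lev p) K) => [_|/St ->]; case: (leqP (lev p) K.+1) => //.
  by move/ot ->.
by move/ot ->.
Qed.

Lemma unode_eq_low p S o (h : legal p S o) t :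
  upos t = p -> lev p <= K -> t = mkunode h.
Proof.
by move=> tp pK; apply: unode_eq => //; [|move/ltnW]; rewrite ltnNge pK.
Qed.

Lemma upos_mk p S o (h : legal p S o) : upos (mkunode h) = p.
Proof. by []. Qed.

Lemma uset_mk p S o (h : legal p S o) : K < lev p -> uset (mkunode h) = S.
Proof. by rewrite /uset /= ltnNge; case: leqP. Qed.

Lemma uopt_mk p S o (h : legal p S o) : K.+1 < lev p -> uopt (mkunode h) = o.
Proof. by rewrite /uopt /= ltnNge; case: leqP. Qed.

Lemma legal_low p S o : lev p <= K -> legal p S o.
Proof. by move=> pK; split; lia. Qed.

Lemma legal_par p S o : legal p S o -> legal (par p) S o.
Proof.
move=> [H1 H2]; split; rewrite lev_par => pK.
  by rewrite anc_par; [apply: H1|]; lia.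
have {H1 H2} : legal_option p S o by apply: H2; lia.
case: o => [u [uK eu cu Wu]|H] /=.
  split=> //; rewrite lev_par par_anc anc_minn minnC -anc_minn cu anc_minn.
  by congr anc; lia.
move=> m; rewrite lev_par => mp; rewrite par_anc anc_minn.
rewrite (_ : minn _ _ = m); last by lia.
by apply: H; lia.
Qed.

Definition upar (t : unode) : unode := mkunode (legal_par (ulegal t)).

Lemma winII_odd S p q : odd (lev p) -> child p q -> ~ winII S p -> ~ winII S q.
Proof. by move=> op pq; apply: contra_not; exact: attractor_own. Qed.

Lemma winII_even S p : ~~ odd (lev p) -> ~ winII S p ->
  exists2 q, child p q & ~ winII S q.
Proof.
move=> op nW; apply: contrapT => H; apply: nW; apply: attractor_opp.
  exact: negPf.
by move=> q pq; apply: contrapT => nWq; apply: H; exists q.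
Qed.

Lemma winI_even S p q : ~~ odd (lev p) -> child p q -> ~ winII S q ->
  ~ winI S p -> ~ winI S q.
Proof.
by move=> op pq Dq; apply: contra_not; apply: attractor_own => //; exact: negPf.
Qed.

Lemma winI_odd S p : odd (lev p) -> ~ winI S p ->
  exists2 q, child p q & ~ winI S q.
Proof.
move=> op nW; apply: contrapT => H; apply: nW; apply: attractor_opp => //.
by move=> q pq; apply: contrapT => nWq; apply: H; exists q.
Qed.

(** The strategy has to be followed only up to the first exit. Until then [winII S] is avoided: no
    move of the second player enters it from outside, and the attractor restricts the first player
    to its complement. *)
Lemma exit_strategy S : exists w, strategy w /\
  forall x n, play x -> ~ winII S (x n) -> winI S (x n) ->
  (forall m, n <= m -> ~~ odd m -> (forall j, n <= j <= m -> ~ exit (x j)) ->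
    x m.+1 = w (x m)) ->
  exists m, [/\ n <= m, exit (x m), forall j, n <= j < m -> ~ exit (x j) &
    forall j, n <= j <= m -> ~ winII S (x j)].
Proof.
have [w [sw wD wP]] := attractor_strategy false (~` winII S) exit.
exists w; split=> // x n px Dn Wn fx.
have [m' nm' [Em' Wj]] : exists2 m, n <= m & exit (x m) /\
    forall j, n <= j <= m -> winI S (x j).
  by apply: wP => // m nm /negbT om _; exact: fx.
have [|m [[nm Em] mP]] := @nat_least (fun m => n <= m /\ exit (x m)).
  by exists m'.
have nE j : n <= j < m -> ~ exit (x j).
  by move=> /andP[nj jm] Ej; apply: (mP j jm).
have mm' : m <= m' by rewrite leqNgt; apply/negP => /mP[].
exists m; split=> // j; elim: j => [|j IHj] /andP[nj jm].
  by have <- : n = 0 by lia.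
move: nj; rewrite leq_eqVlt => /predU1P[<-//|nj].
have Dj : ~ winII S (x j) by apply: IHj; lia.
have pj := px.2 j; case oj : (odd j).
  by apply: winII_odd pj Dj; rewrite play_lev.
rewrite fx //; last 2 first.
- by rewrite oj.
- by move=> i ij; apply: nE; lia.
have Wxj : winI S (x j) by apply: Wj; lia.
by have [||_ //] := wD _ Wxj; [apply: nE; lia|rewrite play_lev].
Qed.

Lemma legal_play_none S x m : play x ->
  (forall j, K < j <= m -> ~ winII S (x j)) ->
  (forall j, K.+1 < j <= m -> ~ winI S (x j)) -> legal (x m) S None.
Proof.
move=> px H1 H2; split; rewrite play_lev // => mK.
  by rewrite anc_play //; apply: H1; lia.
move=> j; rewrite play_lev // => jm; rewrite anc_play //; last by lia.
by split; [apply: H1|apply: H2]; lia.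
Qed.

Lemma legal_play_some S x n m : play x -> K.+1 < n -> exit (x n) ->
  (forall j, K < j <= n -> ~ winII S (x j)) -> legal (x m) S (Some (x n)).
Proof.
move=> px nK En H; split; rewrite play_lev // => mK.
  by rewrite anc_play //; apply: H; lia.
split; rewrite ?play_lev //.
  case: (leqP n m) => nm.
    by rewrite anc_play // anc_id ?play_lev.
  by rewrite anc_id ?play_lev 1?ltnW // anc_play // ltnW.
by move=> j jn; rewrite anc_play //; [apply: H|]; lia.
Qed.

Lemma legal_none_winII S x m j : play x -> legal (x m) S None -> K < j <= m ->
  ~ winII S (x j).
Proof.
move=> px [H1 H2] jm; have [jK|jK] := eqVneq j K.+1.
  subst j; move: H1; rewrite play_lev // anc_play //; last by lia.
  by apply; lia.
have mK : K.+1 < m by lia.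
move: H2; rewrite play_lev // => /(_ mK j); rewrite play_lev // anc_play //; last by lia.
by move=> H; apply: (H _).1; lia.
Qed.

Lemma legal_none_winI S x m j : play x -> legal (x m) S None ->
  K.+1 < j <= m -> ~ winI S (x j).
Proof.
move=> px [H1 H2] jm; have mK : K.+1 < m by lia.
move: H2; rewrite play_lev // => /(_ mK j); rewrite play_lev // anc_play //; last by lia.
by move=> H; apply: (H _).2; lia.
Qed.

(** No legal position is a dead end, which makes the unraveled tree pruned. *)
Lemma legal_extend p S o : legal p S o -> exists q S' o',
  [/\ child p q, legal q S' o', K < lev p -> S' = S & K.+1 < lev p -> o' = o].
Proof.
move=> pL; have [s ss] := exists_strategy T.
have [x px [xp xs]] := play_through p ss.
have thr q : child p q -> exists2 y, play y & y (lev p).+1 = q /\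
    forall j, j <= lev p -> y j = x j.
  move=> pq; have [y py [yq _]] := play_through q ss; exists y => //.
  rewrite -pq.1; split=> // j jp; rewrite -(anc_play py jp) -(anc_play px jp).
  by rewrite xp -{2}pq.2 -yq pq.1 (py.2 _).2.
have pqK q : child p q -> lev q = (lev p).+1 by case.
have [pK|pK|pK] := ltngtP (lev p) K.
- have [q pq] := pruned p; exists q, S, o; split=> //.
  by apply: legal_low; rewrite (pqK q pq).
- have [pK1|pK1] := eqVneq (lev p) K.+1; last first.
    have {}pK : K.+1 < lev p by lia.
    move: pL; case: o => [u|] pL.
      case: (pL) => H1 /(_ pK)[uK Eu cu Wu].
      have [y py yS] : exists2 y, play y &
          y (lev p) = p /\ y (lev u) = u.
        have [pu|up] := leqP (lev u) (lev p).
          exists x => //; split=> //.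
          by rewrite -(anc_play px pu) xp cu anc_id.
        have [y py [yu _]] := play_through u ss; exists y => //; split=> //.
        rewrite -(anc_play py (ltnW up)) yu -cu anc_id //; exact: ltnW.
      exists (y (lev p).+1), S, (Some u); split=> //.
        by have := py.2 (lev p); rewrite yS.1.
      rewrite -yS.2; apply: legal_play_some => //; rewrite ?yS.2 // => j ju.
      by rewrite -(@anc_play _ y _ (lev u)) //; [rewrite yS.2; exact: Wu|lia].
    rewrite -{1}xp in pL.
    have D := legal_none_winII px pL; have W := legal_none_winI px pL.
    (* At the turn of the second player all moves avoid [winII S] and some move avoids [winI S]; at
       the turn of the first, a move avoiding [winII S] also avoids [winI S]. *)
    have [q pq [Dq Wq]] : exists2 q, child p q & ~ winII S q /\ ~ winI S q.
      have Dp : ~ winII S p by rewrite -xp; apply: D; lia.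
      have Wp : ~ winI S p by rewrite -xp; apply: W; lia.
      case op : (odd (lev p)).
        have [q pq Wq] := winI_odd op Wp; exists q => //; split=> //.
        exact: winII_odd pq Dp.
      have [q pq Dq] := winII_even (negbT op) Dp; exists q => //; split=> //.
      exact: (winI_even (negbT op) pq).
    exists q, S, None; split=> //.
    have [y py [yq yx]] := thr q pq; rewrite -yq; apply: legal_play_none => //.
      move=> j jp; have [->|jp'] := eqVneq j (lev p).+1; first by rewrite yq.
      by rewrite yx; [apply: D|]; lia.
    move=> j jp; have [->|jp'] := eqVneq j (lev p).+1; first by rewrite yq.
    by rewrite yx; [apply: W|]; lia.
  have [q pq] := pruned p.
  have Dp : ~ winII S p by have := pL.1 pK; rewrite anc_id // pK1.
  have op : odd (lev p) by rewrite pK1 /=.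
  have Dq : ~ winII S q by exact: winII_odd pq Dp.
  have [y py [yq yx]] := thr q pq.
  have yK : y K.+1 = p by rewrite -pK1 yx.
  (* One of the options is always available: inside [winI S] the exit strategy supplies an exit to
     name, outside it [None] is legal. *)
  have [Wq|Wq] := pselect (winI S q).
    have [w [sw wP]] := exit_strategy S.
    have [z pz [zq zw]] := play_through q sw.
    have [|||m [qm Em _ Dm]] := wP z (lev q) pz; rewrite ?zq //.
      by move=> m qm _ _; exact: zw.
    rewrite (pqK q pq) pK1 in zq qm Dm.
    have zK : z K.+1 = p.
      by rewrite -(anc_play pz (leqnSn K.+1)) zq -yq pK1 (anc_play py).
    exists q, S, (Some (z m)); split=> //; last by lia.
    rewrite -zq; apply: legal_play_some => // j jm.
    have [->|jK] := eqVneq j K.+1; first by rewrite zK.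
    by apply: Dm; lia.
  exists q, S, None; split=> //; last by lia.
  rewrite -yq pK1; apply: legal_play_none => // j jK.
    have [->|jK'] := eqVneq j K.+1; first by rewrite yK.
    by rewrite (_ : j = (lev p).+1) ?yq //; lia.
  by rewrite (_ : j = (lev p).+1) ?yq //; lia.
(* The empty promise cannot be refuted. *)
- have [q pq] := pruned p; exists q, set0, None; split=> //; last by lia.
  have qK := pqK q pq; split=> [_|]; last by lia.
  by rewrite anc_id ?qK ?pK // => /attractor_set0.
Qed.

Program Definition unravel_tree : tree :=
  @Tree unode (fun t => lev (upos t)) upar _ _ _.
Next Obligation. by move=> t; rewrite /= lev_par. Qed.
Next Obligation.
move=> t t0; apply/esym/unode_eq => //; by rewrite par_root.
Qed.
Next Obligation.
move=> t; have [q [S [opt [[lq pq] qL eS eo]]]] := legal_extend (ulegal t).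
exists (mkunode qL); split=> //; apply/esym/unode_eq => /=.
- by rewrite pq.
- by rewrite pq => tK; rewrite uset_mk ?eS // lq; lia.
- by rewrite pq => tK; rewrite uopt_mk ?eo // lq; lia.
Qed.

Program Definition unravel_map : tree_map unravel_tree T :=
  @TreeMap unravel_tree T upos _ _.
Next Obligation. by []. Qed.
Next Obligation. by []. Qed.

Lemma uset_child (t t' : unravel_tree) :
  child t t' -> K < lev t -> uset t' = uset t.
Proof.
by move=> [_ <-] tK; rewrite uset_mk.
Qed.

Lemma uopt_child (t t' : unravel_tree) :
  child t t' -> K.+1 < lev t -> uopt t' = uopt t.
Proof.
by move=> [_ <-] tK; rewrite uopt_mk.
Qed.

Lemma child_mk p q S o (h : legal p S o) (h' : legal q S o) :
  child p q -> child (mkunode h : unravel_tree) (mkunode h' : unravel_tree).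
Proof.
move=> [lq pq]; split=> //; apply/unode_eq => //= pK.
  by rewrite uset_mk /= ?pq // uset_mk // lq ltnW.
by rewrite uopt_mk /= ?pq // uopt_mk // lq ltnW.
Qed.

(** The option decides the game: a named exit has to be passed through, while [None] forbids [winI],
    hence every later exit. *)
Lemma unravel_clopen :
  play_open (~` A) -> play_clopen [set x | A (unravel_map \o x)].
Proof.
move=> clA; have key x : play x ->
    A (unravel_map \o x) <-> uopt (x K.+2) = None.
  move=> px; have px' := play_tmap unravel_map px.
  have oE j : uopt (x (K.+2 + j)) = uopt (x K.+2).
    elim: j => [|j <-]; first by rewrite addn0.
    by rewrite addnS; apply: uopt_child (px.2 _) _; rewrite play_lev //; lia.
  have lx n : legal (unravel_map (x n)) (uset (x n)) (uopt (x n)).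
    exact: ulegal.
  split=> [Ax|xN].
    case xu : (uopt (x K.+2)) => [u|] //; exfalso.
    have [uK _ _ _] : legal_option (unravel_map (x K.+2)) (uset (x K.+2)) (Some u).
      by rewrite -xu; apply: (lx _).2; rewrite (play_lev _ px').
    have := (lx (lev u)).2; rewrite (play_lev _ px') => /(_ uK).
    rewrite (_ : lev u = K.+2 + (lev u - K.+2)); last by lia.
    rewrite oE xu (_ : K.+2 + (lev u - K.+2) = lev u); last by lia.
    case=> _ Eu; rewrite anc_id ?(play_lev _ px') // anc_id // => xE _.
    exact: Eu px' xE Ax.
  apply: contrapT => nA; have [n nP] := clA _ px' nA.
  have lN : legal (unravel_map (x (K.+2 + n))) (uset (x (K.+2 + n))) None.
    by rewrite -xN -(oE n); exact: lx.
  have /= := @legal_none_winI _ (unravel_map \o x) _ (K.+2 + n) px' lN.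
  apply; first by lia.
  apply: attractor_target => y py yx; apply: nP => //.
  rewrite (play_lev _ px') in yx.
  by apply: (play_eq py px' _ yx); lia.
split=> x px Ax; exists K.+2 => y py yx.
  by apply/(key _ py); rewrite yx; apply/(key _ px).
by move=> /(key _ py); rewrite yx => /(key _ px).
Qed.

(** * Transferring strategies from the unraveled tree *)

Section Simulation.
Variable s : unravel_tree -> unravel_tree.
Hypothesis ss : strategy s.

(** The fallback [w] is meant for positions where the pretended announcements have become illegal
    because [winI S] or [winII S] was entered; it exploits this. *)
Definition consult (w : set T -> T -> T) (p : T) (S : set T) (o : option T) : T :=
  if pselect (legal p S o) is left h then upos (s (mkunode h)) else w S p.

Lemma consult_legal w p S o (h : legal p S o) :
  consult w p S o = upos (s (mkunode h)).
Proof.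
rewrite /consult; case: pselect => // h'.
by rewrite (Prop_irrelevance h h').
Qed.

Lemma consult_illegal w p S o : ~ legal p S o -> consult w p S o = w S p.
Proof. by rewrite /consult; case: pselect. Qed.

Lemma consult_child w p S o : (forall S, strategy (w S)) ->
  child p (consult w p S o).
Proof.
move=> sw; have [h|h] := pselect (legal p S o).
  rewrite (consult_legal w h) -{1}(upos_mk h).
  exact: (child_tmap unravel_map (ss (mkunode h))).
by rewrite consult_illegal //; exact: sw.
Qed.

Lemma consult_low w S o (t : unravel_tree) :
  lev t <= K -> consult w (upos t) S o = upos (s t).
Proof.
move=> tK; rewrite (consult_legal w (legal_low S o tK)); congr (upos (s _)).
exact/esym/unode_eq_low.
Qed.

(** One [S] and one [o] serve at all levels, as [mkunode] erases announcements not yet made; they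
    need to be matched with [s] only where they are made. *)
Lemma simulate b x S o (h : forall m, legal (x m) S o) : play x ->
  (forall m, odd m = b -> upos (s (mkunode (h m))) = x m.+1) ->
  (odd K = b -> uset (s (mkunode (h K))) = S) ->
  (odd K.+1 = b -> uopt (s (mkunode (h K.+1))) = o) ->
  exists2 x' : nat -> unravel_tree, play x' /\ follows b s x' &
    unravel_map \o x' = x.
Proof.
move=> px xs xS xo; exists (fun m => mkunode (h m)) => //.
split.
  split=> [|n]; first exact: px.1.
  by apply: child_mk; exact: px.2.
have lm m : lev (mkunode (h m) : unravel_tree) = m by exact: play_lev px.
move=> m bm; apply/esym/unode_eq; rewrite ?(play_lev _ px).
- exact: xs.
- rewrite ltnS leq_eqVlt => /predU1P[Km|Km]; first by subst m; exact: xS.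
  by rewrite (uset_child (ss _)) ?lm // uset_mk // play_lev.
- rewrite ltnS leq_eqVlt => /predU1P[Km|Km]; first by subst m; exact: xo.
  by rewrite (uopt_child (ss _)) ?lm // uopt_mk // play_lev.
Qed.

(** A legal answer is comparable with the named exit, which leaves a single move below it. *)
Lemma forced_move x S n m (h : legal (x m) S (Some (x n))) : play x ->
  K < m < n -> uset (s (mkunode h)) = S -> uopt (s (mkunode h)) = Some (x n) ->
  upos (s (mkunode h)) = x m.+1.
Proof.
move=> px mn eS eo; have [lq _] := child_tmap unravel_map (ss (mkunode h)).
move: lq; rewrite /= (play_lev _ px) => lq.
have := (ulegal (s (mkunode h))).2; rewrite lq eo => -[|_ _ + _]; first by lia.
by rewrite play_lev // lq anc_id ?lq ?anc_play //; lia.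
Qed.

Definition is_first (Q : set T) (p u : T) := exists m,
  [/\ K.+1 < m <= lev p, u = anc m p, Q u &
      forall j, K.+1 < j < m -> ~ Q (anc j p)].

Definition first (Q : set T) (p : T) : option T :=
  if pselect (exists u, is_first Q p u) is left h then Some (sval (cid h))
  else None.

Lemma first_none Q x m : play x -> (forall j, K.+1 < j <= m -> ~ Q (x j)) ->
  first Q (x m) = None.
Proof.
move=> px H; rewrite /first; case: pselect => // h; exfalso.
case: h => u [j [jm eu Qu _]]; move: jm Qu; rewrite eu play_lev // => jm.
by rewrite anc_play //; [exact: H|lia].
Qed.

Lemma first_some Q x n m : play x -> K.+1 < n <= m -> Q (x n) ->
  (forall j, K.+1 < j < n -> ~ Q (x j)) -> first Q (x m) = Some (x n).
Proof.
move=> px nm Qn H; rewrite /first; case: pselect => [h|]; last first.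
  case; exists (x n); exists n; split=> //; first by rewrite play_lev.
    by rewrite anc_play //; lia.
  by move=> j jn; rewrite anc_play; [exact: H| |lia].
congr Some; case: cid => u [j []] /=; rewrite play_lev // => jm -> {u}.
rewrite anc_play //; last by lia.
move=> Qj Hj; case: (ltngtP j n) => jn; last by rewrite jn.
  by case: (H j) => //; lia.
case: (Hj n); first by lia.
by rewrite anc_play //; lia.
Qed.

Definition exit_move (S : set T) : T -> T := sval (cid (exit_strategy S)).

Definition promise (p : T) : set T :=
  uset (s (mkunode (legal_low set0 None (lev_anc_le K p)))).

Definition strategyI (p : T) : T :=
  consult exit_move p (promise p) (first exit p).

Lemma exit_moveP S : strategy (exit_move S).
Proof. by rewrite /exit_move; case: cid => w []. Qed.

(* The play is simulated with the option [None] until it enters [winI], if ever;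
   from there the first player forces an exit [u], and in retrospect the second
   player had chosen [Some u], which made all moves up to [u] forced. *)
Lemma lift_strategyI x : play x -> follows false strategyI x ->
  exists2 x' : nat -> unravel_tree, play x' /\ follows false s x' &
    unravel_map \o x' = x.
Proof.
move=> px fx; pose S := promise (x K).
have SE m : K <= m -> promise (x m) = S.
  move=> Km; rewrite /S /promise; congr (uset (s _)).
  by apply: sval_inj => /=; rewrite (anc_play px Km) (anc_play px (leqnn K)).
have lowI m S' o (h : legal (x m) S' o) : m <= K -> ~~ odd m ->
    upos (s (mkunode h)) = x m.+1.
  move=> mK om; rewrite fx; last exact: negPf.
  by rewrite /strategyI -[in RHS](upos_mk h) consult_low // /= play_lev.
have setK o (h : legal (x K) S o) : uset (s (mkunode h)) = S.
  rewrite /S /promise; congr (uset (s _)).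
  apply: unode_eq_low (lev_anc_le K (x K)).
  exact: (esym (anc_play px (leqnn K))).
have DK : ~ winII S (x K.+1).
  have lK : legal (x K) S None by apply: legal_low; rewrite play_lev.
  have [+ _] := ulegal (s (mkunode lK)).
  rewrite setK (lowI K) // play_lev // => /(_ (ltnSn K)).
  by rewrite anc_play.
have strI m : ~~ odd m -> K < m ->
    x m.+1 = consult exit_move (x m) S (first exit (x m)).
  by move=> om Km; rewrite fx ?(negPf om) // /strategyI SE // ltnW.
have stepI m o (h : legal (x m) S o) : ~~ odd m -> K < m ->
    first exit (x m) = o -> upos (s (mkunode h)) = x m.+1.
  by move=> om Km fo; rewrite strI // fo consult_legal.
have childS m o (h : legal (x m) S o) : K < m -> uset (s (mkunode h)) = S.
  by move=> Km; rewrite (uset_child (ss _)) ?uset_mk //= play_lev.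
have childO m o (h : legal (x m) S o) : K.+1 < m -> uopt (s (mkunode h)) = o.
  by move=> Km; rewrite (uopt_child (ss _)) ?uopt_mk //= play_lev.
have noexit m : ~ winI S (x m) -> ~ exit (x m).
  by apply: contra_not; exact: attractor_target.
(* From an even level above [K], [s] moves at a legal position with option [None] and its answer is
   again legal; from odd levels no move enters [winII S]. *)
have D m : K < m -> (forall j, K.+1 < j < m -> ~ winI S (x j)) ->
    ~ winII S (x m).
  elim/ltn_ind: m => m IH Km Wj.
  have [->//|mK] := eqVneq m K.+1.
  case: m => // m in IH Km Wj mK *.
  have Dj j : K < j <= m -> ~ winII S (x j).
    by move=> jm; apply: IH; [lia|lia|move=> i ij; apply: Wj; lia].
  have Dm : ~ winII S (x m) by apply: Dj; lia.
  case om : (odd m).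
    by apply: winII_odd (px.2 m) Dm; rewrite play_lev.
  have mK1 : m <> K.+1 by move=> mK1; move: om evenK; rewrite mK1 /= => ->.
  have l : legal (x m) S None.
    by apply: legal_play_none => // j jm; apply: Wj; lia.
  have fN : first exit (x m) = None.
    by apply: first_none => // j jm; apply/noexit/Wj; lia.
  have xm := stepI m _ l (negbT om) _ fN.
  have := ulegal (s (mkunode l)); rewrite childS ?childO ?xm; try by lia.
  by move=> lS; apply: (legal_none_winII px lS); lia.
have [/nat_least[m0 [[Km0 W0] m0P]]|nW] := pselect (exists m, K.+1 < m /\ winI S (x m)); last first.
  have nWj j : K.+1 < j -> ~ winI S (x j) by move=> jK Wj; apply: nW; exists j.
  have h m : legal (x m) S None.
    apply: legal_play_none => // j jm; last by apply: nWj; lia.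
    by apply: D; [lia|move=> i ij; apply: nWj; lia].
  apply: (simulate (h := h)) => // [m bm|]; last by rewrite /= evenK.
  have om := negbT bm.
  case: (leqP m K) => mK; first exact: lowI.
  by apply: stepI => //; apply: first_none => // j jm; apply/noexit/nWj; lia.
have nW j : K.+1 < j < m0 -> ~ winI S (x j).
  by move=> jm Wj; apply: (m0P j); [|split=> //]; lia.
have D0 j : K < j <= m0 -> ~ winII S (x j).
  by move=> jm; apply: D; [lia|move=> i ij; apply: nW; lia].
have [m1 [m01 E1 nE1 D1]] : exists m, [/\ m0 <= m, exit (x m),
    forall j, m0 <= j < m -> ~ exit (x j) &
    forall j, m0 <= j <= m -> ~ winII S (x j)].
  have := svalP (cid (exit_strategy S)); rewrite -/(exit_move S) => -[_ wP].
  apply: wP => //; first by apply: D0; lia.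
  (* No exit has been met, so the option is still [None], which is illegal inside [winI S]:
     [consult] falls back on [exit_move]. *)
  move=> m m0m om nE; rewrite strI //; last by lia.
  rewrite (first_none px); last first.
    move=> j jm; have [jm0|jm0] := ltnP j m0; last by apply: nE; lia.
    by apply/noexit/nW; lia.
  by rewrite consult_illegal // => l; apply: (legal_none_winI px l _ W0); lia.
have D1' j : K < j <= m1 -> ~ winII S (x j).
  by move=> jm; have [jm0|jm0] := leqP j m0; [apply: D0|apply: D1]; lia.
have nE1' j : K.+1 < j < m1 -> ~ exit (x j).
  move=> jm; have [jm0|jm0] := ltnP j m0; last by apply: nE1; lia.
  by apply/noexit/nW; lia.
have Km1 : K.+1 < m1 by lia.
have h m : legal (x m) S (Some (x m1)) by exact: legal_play_some.
apply: (simulate (h := h)) => // [m bm|]; last by rewrite /= evenK.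
have om := negbT bm.
case: (leqP m K) => mK; first exact: lowI.
have mK1 : m <> K.+1 by move=> mK1; move: bm evenK; rewrite mK1 /= => ->.
have {mK1} mK1 : K.+1 < m by lia.
case: (ltnP m m1) => mm1.
  by apply: forced_move => //; [lia|exact: childS|exact: childO].
by apply: stepI => //; apply: first_some => //; lia.
Qed.

Definition refute_move (S : set T) : T -> T :=
  sval (cid (attractor_strategy true setT S)).

(* The second player pretends that the first one has promised to avoid all the
   exits which [s] would name in reply to some promise. If such an exit [u] is
   reached, the promise is replaced by one to which [s] answers [u]. *)
Definition answers (p : T) (S : set T) (u : T) :=
  exists h : legal p S None, uopt (s (mkunode h)) = Some u.

Definition named_exits (p : T) : set T := [set u | exists S, answers p S u].

Definition optionII (p : T) : option T := first (named_exits (anc K.+1 p)) p.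

Definition promiseII (p : T) : set T :=
  if optionII p is Some u then some_in set0 [set S | answers (anc K.+1 p) S u]
  else named_exits (anc K.+1 p).

Definition strategyII (p : T) : T :=
  consult refute_move p (promiseII p) (optionII p).

Lemma refute_moveP S : strategy (refute_move S).
Proof. by rewrite /refute_move; case: cid => w []. Qed.

Lemma lift_strategyII x : play x -> follows true strategyII x ->
  exists2 x' : nat -> unravel_tree, play x' /\ follows true s x' &
    unravel_map \o x' = x.
Proof.
move=> px fx; pose c := x K.+1; pose S := named_exits c.
have cE m : K < m -> anc K.+1 (x m) = c by move=> Km; rewrite anc_play.
have lowII m S' o (h : legal (x m) S' o) : m <= K -> odd m ->
    upos (s (mkunode h)) = x m.+1.
  move=> mK om; rewrite fx //.
  by rewrite /strategyII -[in RHS](upos_mk h) consult_low // /= play_lev.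
have childS m S' o (h : legal (x m) S' o) : K < m -> uset (s (mkunode h)) = S'.
  by move=> Km; rewrite (uset_child (ss _)) ?uset_mk //= play_lev.
have childO m S' o (h : legal (x m) S' o) : K.+1 < m -> uopt (s (mkunode h)) = o.
  by move=> Km; rewrite (uopt_child (ss _)) ?uopt_mk //= play_lev.
have [/nat_least[m1 [[Km1 S1] m1P]]|nS] := pselect (exists m, K.+1 < m /\ S (x m)).
  set u := x m1 in S1.
  pose S' := some_in set0 [set S | answers c S u].
  have [l1 lu] : answers c S' u.
    apply: (@some_inP _ set0 [set S | answers c S u]).
    by case: S1 => S0; exists S0.
  have := (ulegal (s (mkunode l1))).2; rewrite lu.
  have [lt _] := child_tmap unravel_map (ss (mkunode l1)).
  move: lt; rewrite /= /c (play_lev _ px) => -> /(_ (ltnSn _))[_ Eu _].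
  rewrite childS // play_lev // => Du.
  have h m : legal (x m) S' (Some u).
    apply: legal_play_some => // j jm; have := Du j jm.
    by rewrite anc_play //; lia.
  have oK : uopt (s (mkunode (h K.+1))) = Some u.
    rewrite -[RHS]lu; congr (uopt (s _)).
    by apply/unode_eq => //= Kc; rewrite ?uset_mk //; move: Kc; rewrite play_lev // ltnn.
  apply: (simulate (h := h)) => //.
    move=> m om; case: (leqP m K) => mK; first exact: lowII.
    case: (ltnP m m1) => mm1.
      apply: forced_move => //; [lia|exact: childS|].
      have [mK1|mK1] := eqVneq m K.+1; last by apply: childO; lia.
      by subst m.
    have oE : optionII (x m) = Some u.
      rewrite /optionII cE //; apply: first_some => //; first by lia.
      by move=> j jm Sj; apply: (m1P j); [lia|split=> //; lia].
    by rewrite fx // /strategyII /promiseII oE cE // consult_legal.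
  by move=> oddK; move: evenK; rewrite oddK.
have nSj j : K.+1 < j -> ~ S (x j) by move=> jK Sj; apply: nS; exists j.
have optN m : K < m -> optionII (x m) = None.
  move=> Km; rewrite /optionII cE //; apply: first_none => // j jm.
  by apply: nSj; lia.
have strII m : odd m -> K < m -> x m.+1 = consult refute_move (x m) S None.
  by move=> om Km; rewrite fx // /strategyII /promiseII optN // cE.
have stepII m (h : legal (x m) S None) : odd m -> K < m ->
    upos (s (mkunode h)) = x m.+1.
  by move=> om Km; rewrite strII // consult_legal.
have nSK : ~ S c.
  move=> [S0 [l0 l0c]]; have := (ulegal (s (mkunode l0))).2; rewrite l0c.
  have [lt _] := child_tmap unravel_map (ss (mkunode l0)).
  move: lt; rewrite /= /c (play_lev _ px) => -> /(_ (ltnSn _))[].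
  by rewrite ltnn.
(* Inside [winII S] the promise is illegal, so [refute_move] takes over and reaches a named exit,
   which the present case excludes. *)
have D m : K < m -> ~ winII S (x m).
  move=> Km Wm; have := svalP (cid (attractor_strategy true setT S)).
  rewrite -/(refute_move S) => -[_ _ /(_ x m px Wm)[]].
    move=> j mj oj Wj _; rewrite strII //; last by lia.
    rewrite consult_illegal // => l.
    by apply: (legal_none_winII px l _ Wj); lia.
  move=> j mj [Sj _]; have [jK|jK] := eqVneq j K.+1.
    by apply: nSK; rewrite /c -jK.
  by apply: (nSj j) => //; lia.
have lK : legal (x K.+1) S None.
  by apply: legal_play_none => // j jm; [apply: D|]; lia.
(* The diagonal step: an exit named in reply to [S] would itself belong to [S], hence to [winII S],
   against legality. *)
have optK (l : legal (x K.+1) S None) : uopt (s (mkunode l)) = None.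
  case lu : (uopt (s (mkunode l))) => [u|] //; exfalso.
  have Su : S u by exists S, l.
  have := (ulegal (s (mkunode l))).2; rewrite lu.
  have [lt _] := child_tmap unravel_map (ss (mkunode l)).
  move: lt; rewrite /= (play_lev _ px) => -> /(_ (ltnSn _))[uK _ _].
  rewrite childS // => /(_ (lev u)); rewrite anc_id // => H.
  by apply: H; [lia|exact: attractor_target].
(* The replies of [s] are legal with [None]; the first player cannot enter [winI S] while moving
   outside [winII S]. *)
have W m : K.+1 < m -> ~ winI S (x m).
  elim/ltn_ind: m => m IH Km; case: m => // m in IH Km *.
  have l : legal (x m) S None.
    by apply: legal_play_none => // j jm; [apply: D|apply: IH]; lia.
  case om : (odd m).
    have xm : upos (s (mkunode l)) = x m.+1 by apply: stepII => //; lia.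
    have oN : uopt (s (mkunode l)) = None.
      have [mK|mK] := eqVneq m K.+1; last by apply: childO; lia.
      by subst m; exact: optK.
    have := ulegal (s (mkunode l)); rewrite xm oN childS; last by lia.
    by move=> lS; apply: (legal_none_winI px lS); lia.
  have mK : m <> K.+1 by move=> mK; move: om evenK; rewrite mK /= => ->.
  apply: (winI_even _ (px.2 m)); rewrite ?play_lev ?om //.
    by apply: D; lia.
  by apply: IH; lia.
have h m : legal (x m) S None.
  by apply: legal_play_none => // j jm; [apply: D|apply: W]; lia.
apply: (simulate (h := h)) => //.
  move=> m om; case: (leqP m K) => mK; first exact: lowII.
  exact: stepII.
by move=> oddK; move: evenK; rewrite oddK.
Qed.

End Simulation.

Definition unravel_strategy (b : bool) s :=
  if b then strategyII s else strategyI s.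

Lemma consult_local s s' w p S o S' o' :
  (forall t : unravel_tree, lev t <= lev p -> s t = s' t) ->
  (K < lev p -> S = S' /\ o = o') ->
  consult s w p S o = consult s' w p S' o'.
Proof.
move=> e eSo; case: (leqP (lev p) K) => [pK|/eSo[<- <-]].
  rewrite !(consult_legal _ _ (legal_low _ _ pK)) e //.
  congr (upos (s' _)).
  exact: unode_eq_low.
rewrite /consult; case: pselect => // h; by rewrite e.
Qed.

Lemma unravel_strategy_local b s s' n :
  (forall t : unravel_tree, lev t <= n -> s t = s' t) ->
  forall p, lev p <= n -> unravel_strategy b s p = unravel_strategy b s' p.
Proof.
move=> e p pn; case: b => /=; apply: consult_local => [t tp|Kp].
- by apply: e; exact: leq_trans pn.
- have aE : answers s (anc K.+1 p) = answers s' (anc K.+1 p).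
    apply/funext => S; apply/funext => u; apply/propext.
    by split=> -[h hu]; exists h; rewrite -hu e // /= lev_anc; lia.
  by rewrite /promiseII /optionII /named_exits aE.
- by apply: e; exact: leq_trans pn.
- by split=> //; rewrite /promise e //= lev_anc; lia.
Qed.

Program Definition unravel_covering : covering K unravel_tree T :=
  @Covering K unravel_tree T unravel_map unravel_strategy _ _ _ _ _ _.
Next Obligation.
move=> t t' tK /= tt'.
rewrite (@unode_eq_low _ _ _ (ulegal t') t) //; first exact/esym/unode_eq.
by rewrite -tt'.
Qed.
Next Obligation. by move=> p pK; exists (mkunode (legal_low set0 None pK)). Qed.
Next Obligation.
move=> [] s ss p; apply: consult_child => // S; first exact: refute_moveP.
exact: exit_moveP.
Qed.
Next Obligation. by move=> b s s' n _ _; exact: unravel_strategy_local. Qed.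
Next Obligation.
by move=> [] s t ss tK; apply: consult_low; exact: ltnW.
Qed.
Next Obligation.
by move=> [] s x ss px fx; [exact: lift_strategyII|exact: lift_strategyI].
Qed.

End Unravel.

(** * Borel determinacy *)

Program Definition covering_le (k K : nat) (T' T : tree) (kK : k <= K)
    (c : covering K T' T) : covering k T' T :=
  @Covering k T' T c (cstr c) _ _ _ _ _ _.
Next Obligation.
by move=> k K T' T kK c p q pk; apply: cmap_inj; exact: leq_trans kK.
Qed.
Next Obligation.
by move=> k K T' T kK c p pk; apply: cmap_surj; exact: leq_trans kK.
Qed.
Next Obligation. by move=> *; exact: cstr_strategy. Qed.
Next Obligation.
by move=> k K T' T kK c b s s' n ss ss' e p pn; apply: (cstr_local c b ss ss' e).
Qed.
Next Obligation.
by move=> k K T' T kK c b s p ss pk; apply: cstr_low => //; exact: leq_trans kK.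
Qed.
Next Obligation. by move=> k K T' T kK c b s x ss px fx; exact: cstr_lift. Qed.

Definition unraveled (k : nat) (T : tree) (A : set (nat -> T)) :=
  exists (T' : tree) (c : covering k T' T), play_clopen [set x | A (c \o x)].

(* Quantifying over all trees above [T0] makes the class of these sets a
   sigma-algebra. *)
Definition unravelable (T0 : tree) (A : set (nat -> T0)) :=
  forall (T : tree) (f : tree_map T T0) k,
    unraveled k [set x : nat -> T | A (f \o x)].

Lemma unraveledC k (T : tree) (A : set (nat -> T)) :
  unraveled k A -> unraveled k (~` A).
Proof.
move=> [T' [c [oA oC]]]; exists T', c; split=> //.
move=> x px /= /contrapT Ax; have [n nP] := oA x px Ax.
by exists n => y py yx; apply; exact: nP yx.
Qed.

Lemma closed_unraveled k (T : tree) (A : set (nat -> T)) :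
  play_open (~` A) -> unraveled k A.
Proof.
(* An even level at least [k]: the promise must be announced at a turn of the first player. *)
move=> clA; have ek : ~~ odd k.*2 by rewrite odd_double.
have kk : k <= k.*2 by rewrite -addnn leq_addr.
exists (unravel_tree A ek), (covering_le kk (unravel_covering A ek)).
exact: unravel_clopen.
Qed.

Lemma open_unraveled k (T : tree) (A : set (nat -> T)) :
  play_open A -> unraveled k A.
Proof.
move=> oA; rewrite -(setCK A); apply/unraveledC/closed_unraveled.
by rewrite setCK.
Qed.

Section Unravelable.
Variable T0 : tree.
Implicit Types A : set (nat -> T0).

Lemma unravelableC A : unravelable A -> unravelable (~` A).
Proof. by move=> uA T f k; exact: (unraveledC (uA T f k)). Qed.

Lemma open_unravelable A : play_open A -> unravelable A.
Proof.
by move=> oA T f k; apply/open_unraveled/play_open_tmap.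
Qed.

(** Stage [i] unravels the pullback of [A i]. Over the limit tree every [A i] is clopen, so the
    union is open, and one more covering unravels it. *)
Lemma bigcup_unravelable (A : nat -> set (nat -> T0)) :
  (forall i, unravelable (A i)) -> unravelable (\bigcup_i A i).
Proof.
move=> uA T f k.
pose st := {T : tree & tree_map T T0}.
have next i (t : st) : {t' : st & {c : covering (k + i) (projT1 t') (projT1 t) |
    projT2 t' = tmap_comp (projT2 t) c /\
    play_clopen [set x | A i (projT2 t' \o x)]}}.
  have [T' h] := cid (uA i (projT1 t) (projT2 t) (k + i)).
  have [c cP] := cid h.
  by exists (existT _ T' (tmap_comp (projT2 t) c)), c.
pose t := nat_rect (fun=> st) (existT _ T f) (fun i u => projT1 (next i u)).
pose c i : covering (k + i) (projT1 (t i.+1)) (projT1 (t i)) :=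
  sval (projT2 (next i (t i))).
have cP i : projT2 (t i.+1) = tmap_comp (projT2 (t i)) (c i) /\
    play_clopen [set x | A i (projT2 (t i.+1) \o x)].
  exact: (svalP (projT2 (next i (t i)))).
pose L := limit_tree c.
have fE i (y : L) : projT2 (t i) (limit_proj c i y) = f (limit_proj c 0 y).
  elim: i => // i <-; rewrite (cP i).1 /=; congr (projT2 (t i) _).
  exact: (svalP y i).
have oA : play_open [set x : nat -> L | (\bigcup_i A i) (f \o (limit_covering c \o x))].
  move=> x px [i _ Ai].
  have [oi _] := play_clopen_tmap (limit_proj c i.+1) (cP i).2.
  have fxE (z : nat -> L) : (projT2 (t i.+1) \o (limit_proj c i.+1 \o z)) =
      f \o (limit_covering c \o z) by apply/funext => n; exact: fE.
  have [|n nP] := oi x px; first by rewrite /= fxE.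
  exists n => y py yx; exists i => //.
  by have := nP y py yx; rewrite /= fxE.
have [T' [d dP]] := open_unraveled k oA.
by exists T', (covering_comp (limit_covering c) d).
Qed.

Lemma unravelableU A B :
  unravelable A -> unravelable B -> unravelable (A `|` B).
Proof.
move=> uA uB; rewrite -bigcup2E; apply: bigcup_unravelable => i.
rewrite /bigcup2; case: ifP => // _; case: ifP => // _.
by apply: open_unravelable => x _ [].
Qed.

Lemma unravelable_determined A r : unravelable A -> lev r = 0 -> determined A r.
Proof.
by move=> uA; have [T' [c]] := uA T0 (tmap_id T0) 0; exact: covering_determined.
Qed.

End Unravelable.

(** * Games of moves *)

Section FullTree.
Variables (M : Type) (m0 : M).

(** Moves are listed latest first, so that the parent is [behead]. *)
Program Definition full_tree : tree :=
  @Tree (seq M) size behead (fun p => size_behead p) _ _.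
Next Obligation. by case. Qed.
Next Obligation. by move=> p; exists (m0 :: p). Qed.

Definition move_at (x : nat -> full_tree) n : M := head m0 (x n.+1).
Definition movesI (x : nat -> full_tree) i : M := move_at x i.*2.
Definition movesII (x : nat -> full_tree) i : M := move_at x i.*2.+1.

Lemma move_at_agree x y n : play x -> play y -> x n = y n ->
  forall i, i < n -> move_at x i = move_at y i.
Proof. by move=> px py xy i ni; rewrite /move_at (play_eq px py ni xy). Qed.

Section Answer.
Variables (b : bool) (s : full_tree -> full_tree).
Hypothesis ss : strategy s.

Fixpoint answer_play (z : nat -> M) n : full_tree :=
  if n is n'.+1 then
    if odd n' == b then s (answer_play z n') else z n'./2 :: answer_play z n'
  else [::].

Lemma answer_playP z : play (answer_play z) /\ follows b s (answer_play z).
Proof.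
split=> [|n bn]; last by rewrite /= bn eqxx.
split=> // n /=; case: eqP => _; first exact: ss.
by [].
Qed.

Lemma answer_play_agree z z' n :
  (forall i, i < n -> odd i != b -> z i./2 = z' i./2) ->
  answer_play z n = answer_play z' n.
Proof.
elim: n => //= n IHn H; rewrite IHn; last by move=> i ni; apply: H; exact: ltnW.
by case: eqP => // /eqP ob; rewrite (H n).
Qed.

End Answer.

(* In each disjunct the winner is represented by the map turning the sequence
   of all moves of the opponent into the sequence of his own moves. *)
Lemma unravelable_moves (Q : (nat -> M) -> (nat -> M) -> Prop) :
  @unravelable full_tree [set x | Q (movesI x) (movesII x)] ->
  (exists G : (nat -> M) -> nat -> M,
    (forall v v' n, (forall i, i < n -> v i = v' i) -> G v n = G v' n) /\
    forall v, Q (G v) v) \/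
  (exists F : (nat -> M) -> nat -> M,
    (forall z z' n, (forall i, i <= n -> z i = z' i) -> F z n = F z' n) /\
    forall z, ~ Q z (F z)).
Proof.
move=> uQ.
have [b [s [ss sW]]] := @unravelable_determined full_tree _ [::] uQ erefl.
case: b sW => sW; [right|left].
  exists (fun z => movesII (answer_play true s z)); split=> [z z' n H|z].
    rewrite /movesII /move_at (@answer_play_agree true s z z') // => i ni oi.
    by apply: H; move: oi; rewrite eqb_id => oi; lia.
  have [px fx] := answer_playP true ss z; have := sW _ px erefl fx.
  rewrite /= (_ : movesI _ = z) //; apply/funext => i.
  by rewrite /movesI /move_at /= odd_double doubleK.
exists (fun z => movesI (answer_play false s z)); split=> [z z' n H|z].
  rewrite /movesI /move_at (@answer_play_agree false s z z') // => i ni oi.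
  by apply: H; move: oi; rewrite eqbF_neg negbK => oi; lia.
have [px fx] := answer_playP false ss z; have := sW _ px erefl fx.
rewrite /= (_ : movesII _ = z) //; apply/funext => i.
by rewrite /movesII /move_at /= odd_double /= uphalf_double.
Qed.

End FullTree.

(** * Baire category in Cantor space *)

Section Category.
Implicit Types (z : nat -> bool) (Z U : set (nat -> bool)).

Definition agree n z z' := forall i, i < n -> z i = z' i.

Definition bits_open U := forall z, U z -> exists n, forall z', agree n z z' -> U z'.

Definition nowhere_dense Z := forall z n,
  exists z' m, agree n z z' /\ forall y, agree m z' y -> ~ Z y.

Definition meager Z := exists2 Q : nat -> set (nat -> bool),
  forall i, nowhere_dense (Q i) & Z `<=` \bigcup_i Q i.

Definition baire_property Z := exists2 U, bits_open U &
  meager ((Z `\` U) `|` (U `\` Z)).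

Lemma agree_trans n z z' z'' : agree n z z' -> agree n z' z'' -> agree n z z''.
Proof. by move=> H H' i ni; rewrite H ?H'. Qed.

Lemma agree_le n m z z' : m <= n -> agree n z z' -> agree m z z'.
Proof. by move=> mn H i im; apply: H; exact: leq_trans mn. Qed.

Lemma meager_sub Z Z' : Z `<=` Z' -> meager Z' -> meager Z.
Proof. by move=> ZZ' [Q Qn ZQ]; exists Q => //; exact: subset_trans ZQ. Qed.

Lemma meager_bigcup (Z : nat -> set (nat -> bool)) :
  (forall i, meager (Z i)) -> meager (\bigcup_i Z i).
Proof.
move=> mZ.
have /choice[Q QP] : forall i, exists Q : nat -> set (nat -> bool),
    (forall j, nowhere_dense (Q j)) /\ Z i `<=` \bigcup_j Q j.
  by move=> i; have [Q ? ?] := mZ i; exists Q.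
pose P n := if unpickle n is Some ij then Q (ij : nat * nat).1 ij.2 else set0.
exists P => [n|z [i _ /((QP i).2)[j _ Qz]]]; last first.
  by exists (pickle (i, j)) => //; rewrite /P pickleK.
rewrite /P; case: unpickle => [[i j]|]; first exact: (QP i).1.
by move=> z n'; exists z, 0; split=> // y _ [].
Qed.

Lemma meagerU Z Z' : meager Z -> meager Z' -> meager (Z `|` Z').
Proof.
move=> mZ mZ'; have : meager (\bigcup_i (if i is 0 then Z else Z')).
  by apply: meager_bigcup; case.
by apply: meager_sub => z [Zz|Zz]; [exists 0|exists 1].
Qed.

Lemma nowhere_dense_meager Z : nowhere_dense Z -> meager Z.
Proof. by move=> nZ; exists (fun=> Z) => // z Zz; exists 0. Qed.

Lemma baire_propertyC Z : baire_property Z -> baire_property (~` Z).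
Proof.
move=> [U oU mU].
(* [V] is the exterior of [U]; only the boundary of [U] is lost, and it is nowhere dense. *)
pose V := [set z | exists n, forall z', agree n z z' -> ~ U z'].
exists V.
  move=> z [n nU]; exists n => z' zz'; exists n => y z'y.
  by apply: nU; exact: agree_trans zz' z'y.
have nd : nowhere_dense (~` U `\` V).
  move=> z n; have [[z' [m [zz' z'U]]]|nU] :=
      pselect (exists z' m, agree n z z' /\ forall y, agree m z' y -> U y).
    by exists z', m; split=> // y /z'U Uy [].
  exists z, n; split=> // y zy [_]; apply; exists n => y' yy' Uy'.
  have [m ?] := oU _ Uy'; apply: nU; exists y', m; split=> //.
  exact: agree_trans zy yy'.
apply: meager_sub (meagerU mU (nowhere_dense_meager nd)) => z.
have VU : V z -> ~ U z by case=> n; apply.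
case=> [[nZ nV]|[Vz /contrapT Zz]].
  by have [Uz|nU] := pselect (U z); [left; right|right].
by left; left; split=> //; exact: VU.
Qed.

Lemma baire_property_bigcup (Z : nat -> set (nat -> bool)) :
  (forall i, baire_property (Z i)) -> baire_property (\bigcup_i Z i).
Proof.
move=> bZ; have /choice[U UP] : forall i, exists U, bits_open U /\
    meager ((Z i `\` U) `|` (U `\` Z i)).
  by move=> i; have [U ? ?] := bZ i; exists U.
exists (\bigcup_i U i).
  move=> z [i _ Ui]; have [n nU] := (UP i).1 z Ui.
  by exists n => z' /nU; exists i.
apply: meager_sub (meager_bigcup (fun i => (UP i).2)) => z.
case=> [[[i _ Zi] nU]|[[i _ Ui] nZ]]; exists i => //; [left|right]; split=> //.
  by move=> Ui; apply: nU; exists i.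
by move=> Zi; apply: nZ; exists i.
Qed.

Lemma open_baire_property Z : bits_open Z -> baire_property Z.
Proof.
move=> oZ; exists Z => //; exists (fun=> set0) => [i z n|z]; last by case=> -[].
by exists z, 0; split=> // y _ [].
Qed.

Lemma baire_category z n : ~ meager [set z' | agree n z z'].
Proof.
move=> [Q Qn sub].
have step i (zn : (nat -> bool) * nat) : {zm : (nat -> bool) * nat |
    [/\ agree zn.2 zn.1 zm.1, zn.2 < zm.2 &
        forall y, agree zm.2 zm.1 y -> ~ Q i y]}.
  apply/cid; have [z' [m [zz' mQ]]] := Qn i zn.1 zn.2.
  (* The successor makes the lengths grow strictly, so bit [i] is settled at stage [i.+1]. *)
  exists (z', (maxn m zn.2).+1); split=> //=; first by lia.
  by move=> y /agree_le yz; apply/mQ/yz; lia.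
pose a := nat_rect (fun=> ((nat -> bool) * nat)%type) (z, n)
  (fun i zn => sval (step i zn)).
have aP i : [/\ agree (a i).2 (a i).1 (a i.+1).1, (a i).2 < (a i.+1).2 &
    forall y, agree (a i.+1).2 (a i.+1).1 y -> ~ Q i y].
  exact: (svalP (step i (a i))).
have a_ge i : i <= (a i).2.
  by elim: i => // i IHi; have [_ lt_a _] := aP i; exact: leq_ltn_trans lt_a.
have a_mono i j : agree (a i).2 (a i).1 (a (i + j)).1 /\ (a i).2 <= (a (i + j)).2.
  elim: j => [|j [IH1 IH2]]; rewrite ?addn0 ?addnS //.
  have [ag lt_a _] := aP (i + j); split; last by lia.
  exact: agree_trans IH1 (agree_le IH2 ag).
pose y i := (a i.+1).1 i.
have ay i : agree (a i).2 (a i).1 y.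
  move=> j ji; rewrite /y; have [ij|ji'] := leqP i j.+1.
    by rewrite -(subnKC ij); exact: (a_mono i (j.+1 - i)).1.
  rewrite -(subnKC (ltnW ji')); apply/esym.
  by apply: (a_mono j.+1 (i - j.+1)).1; exact: leq_trans (a_ge j.+1).
have [|i _ Qi] := sub y; first exact: (ay 0).
by have [_ _ /(_ y (ay i.+1))] := aP i.
Qed.

(** Flipping one bit exchanges [Z] with its complement and preserves meagerness. If [U] contains a
    cylinder of length [n], flipping bit [n] preserves the cylinder, where the complement of [Z] and
    its flipped image are both meager, yet cover it. If [U] is empty, [Z] and its flipped image are
    meager and cover the space. *)
Lemma no_flip_set Z : baire_property Z ->
  ~ (forall z z' n, (forall i, i != n -> z i = z' i) -> z' n = ~~ z n ->
      Z z <-> ~ Z z').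
Proof.
move=> [U oU mU] fl.
pose flip n z i := if i == n then ~~ z i else z i.
have flipZ n z : Z z <-> ~ Z (flip n z).
  apply: (fl _ _ n); rewrite /flip ?eqxx //.
  by move=> i /negPf ->.
have flipK n z : flip n (flip n z) = z.
  by apply/funext => i; rewrite /flip; case: eqP => // _; rewrite negbK.
have agF n m z z' : agree m z z' -> agree m (flip n z) (flip n z').
  by move=> H i im; rewrite /flip H.
have meager_flip n V : meager V -> meager [set z | V (flip n z)].
  move=> [Q Qn VQ]; exists (fun i => [set z | Q i (flip n z)]).
    move=> i z m; have [z' [m' [zz' Qz']]] := Qn i (flip n z) m.
    exists (flip n z'), m'; split.
      by rewrite -(flipK n z); exact: agF.
    by move=> y /(agF n); rewrite flipK; exact: Qz'.
  by move=> z /VQ[i _ Qi]; exists i.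
have [[z Uz]|nU] := pselect (exists z, U z).
  have [n nU] := oU z Uz.
  apply: (@baire_category z n).
  apply: meager_sub (meagerU mU (meager_flip n _ mU)) => y zy.
  have Uy := nU y zy; have [Zy|nZ] := pselect (Z y).
    right; right; split; last exact: (flipZ n y).1.
    by apply: nU => i ni; rewrite /flip ltn_eqF // (zy i ni).
  by left; right.
apply: (@baire_category (fun=> false) 0).
apply: meager_sub (meagerU mU (meager_flip 0 _ mU)) => y _.
have nUy z : ~ U z by move=> Uz; apply: nU; exists z.
have [Zy|nZ] := pselect (Z y); first by left; left.
right; left; split=> //; apply: contrapT => nZf.
by apply: nZ; exact: (flipZ 0 y).2.
Qed.

End Category.

(** * Lipschitz games *)

Import Order.TTheory GRing.Theory Num.Theory.

Local Open Scope ring_scope.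

Lemma Borel_induction (T : topologicalType) (P : set (set T)) :
  (forall A, open A -> P A) -> (forall A, P A -> P (~` A)) ->
  (forall A : nat -> set T, (forall n, P (A n)) -> P (\bigcup_n A n)) ->
  forall A, Borel A -> P A.
Proof.
move=> Po PC PU; apply: smallest_sub => //; split=> [|A PA|A PA].
- by apply: Po; exact: open0.
- by rewrite setTD; exact: PC.
- exact: PU.
Qed.

Section LipschitzGame.
Variables (R : realType) (X : metricType R).
Hypothesis ultraX : ultrametric X.
Hypothesis completeX : complete_metric X.
Variable e : R.
Hypothesis e_gt0 : 0 < e.

Local Notation d := (@mdist R X).

Definition radius (n : nat) : R := e / 2 ^+ n.

Lemma radius_gt0 n : 0 < radius n.
Proof. by rewrite divr_gt0 // exprn_gt0. Qed.

Lemma radiusS n : radius n = 2 * radius n.+1.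
Proof. by rewrite /radius exprS invfM [RHS]mulrCA mulVKf. Qed.

Lemma radius_le m n : (m <= n)%N -> radius n <= radius m.
Proof.
move=> mn; rewrite /radius ler_pM2l // lef_pV2 ?posrE ?exprn_gt0 //.
by rewrite ler_eXn2l // ltr1n.
Qed.

Lemma radius_small (r : R) : 0 < r -> exists n, radius n <= r.
Proof.
move=> r0; exists (Num.bound (e / r)).
rewrite /radius ler_pdivrMr ?exprn_gt0 // -ler_pdivrMl // mulrC.
apply: ltW; apply: lt_le_trans (archi_boundP _) _; first by rewrite divr_ge0 // ltW.
by rewrite -natrX ler_nat ltnW // ltn_expl.
Qed.

Lemma ultra_lt x y z r : d x y < r -> d y z < r -> d x z < r.
Proof.
by move=> xy yz; apply: le_lt_trans (ultraX x y z) _; rewrite gt_max xy.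
Qed.

Lemma ultra_le x y z r : d x y <= r -> d y z <= r -> d x z <= r.
Proof.
by move=> xy yz; apply: le_trans (ultraX x y z) _; rewrite ge_max xy.
Qed.

Lemma mdist_eq0 x y : (forall n, d x y < radius n) -> x = y.
Proof.
move=> H; apply/eqP/negP => /negP; rewrite -mdist_gt0 => /radius_small[n].
by rewrite leNgt H.
Qed.

(** * Points as sequences of moves *)

Section Coding.
Variables (b : X) (D : R).
Hypothesis eD : e <= D.

(* Arbitrary moves [z] are read as a rapidly Cauchy sequence in the ball of
   centre [b] and radius [D], illegal moves being replaced by a repetition. *)
Fixpoint decode (z : nat -> X) n : X :=
  if n is n'.+1 then
    if d (decode z n') (z n) < radius n' then z n else decode z n'
  else if d b (z 0%N) <= D then z 0%N else b.

Lemma decode_step z n : d (decode z n) (decode z n.+1) < radius n.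
Proof. by rewrite /=; case: ifP => // _; rewrite mdistxx radius_gt0. Qed.

Lemma decode_close z n m : (n <= m)%N -> d (decode z n) (decode z m) < radius n.
Proof.
elim: m => [|m IHm].
  by rewrite leqn0 => /eqP ->; rewrite mdistxx radius_gt0.
rewrite leq_eqVlt => /predU1P[->|nm]; first by rewrite mdistxx radius_gt0.
apply: ultra_lt (IHm nm) _; apply: lt_le_trans (decode_step z m) _.
exact: radius_le.
Qed.

Lemma decode_agree z z' n : (forall i, (i <= n)%N -> z i = z' i) ->
  decode z n = decode z' n.
Proof.
elim: n => [|n IHn] H /=; first by rewrite H.
by rewrite H // IHn // => i ni; apply: H; exact: leqW.
Qed.

Lemma decode_limit z : exists x, forall n, d (decode z n) x < radius n.
Proof.
have [|x zx] := completeX (u := decode z).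
  apply: cauchy_exP => r r0; have [n nr] := radius_small r0.
  exists (decode z n); exists n => // m /= nm; rewrite ballEmdist /=.
  exact: lt_le_trans (decode_close z nm) nr.
exists x => n.
have : nbhs x (ball x (radius n)) by apply: nbhsx_ballx; exact: radius_gt0.
move=> /zx[m _ mP]; have := mP (maxn n m) (leq_maxr n m).
rewrite ballEmdist /= metric_sym; apply: ultra_lt.
by apply: decode_close; exact: leq_maxl.
Qed.

Definition read (z : nat -> X) : X :=
  xget b [set x | forall n, d (decode z n) x < radius n].

Lemma readP z n : d (decode z n) (read z) < radius n.
Proof.
have [x xP] := decode_limit z.
have /(_ n) := xgetPex b (ex_intro (fun x => [set x |
  forall n, d (decode z n) x < radius n] x) x xP); exact.
Qed.

Lemma read_agree z z' n : (forall i, (i <= n)%N -> z i = z' i) ->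
  d (read z) (read z') < radius n.
Proof.
move=> H; apply: (@ultra_lt _ (decode z n)).
  by rewrite metric_sym readP.
by rewrite (decode_agree H) readP.
Qed.

Lemma read_bounded z : d b (read z) <= D.
Proof.
apply: (@ultra_le _ (decode z 0%N)).
  by rewrite /=; case: ifP => // _; rewrite mdistxx (le_trans _ eD) // ltW.
by apply: ltW; apply: lt_le_trans (readP z 0) _; rewrite /radius divr1.
Qed.

(** The chosen point depends only on the ball, and points closer than [radius n] have the same
    ball. *)
Definition code (x : X) (n : nat) : X := xget b [set y | d x y < radius n].

Lemma codeP x n : d x (code x n) < radius n.
Proof.
by have := xgetPex b (ex_intro (fun y => [set y | d x y < radius n] y) x _);
  apply; rewrite /= mdistxx radius_gt0.
Qed.

Lemma code_agree x y n m : d x y < radius n -> (m <= n)%N -> code x m = code y m.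
Proof.
move=> xy mn; rewrite /code; congr xget; apply/seteqP.
have {}xy : d x y < radius m by apply: lt_le_trans xy _; exact: radius_le.
by split=> z /=; apply: ultra_lt => //; rewrite metric_sym.
Qed.

Lemma decode_code x n : d b x <= D -> decode (code x) n = code x n.
Proof.
move=> bx; elim: n => [|n /= ->].
  rewrite /= (@ultra_le _ x) //; apply: ltW.
  by apply: lt_le_trans (codeP x 0) _; rewrite /radius divr1.
rewrite (@ultra_lt _ x) //; first by rewrite metric_sym codeP.
by apply: lt_le_trans (codeP x n.+1) _; exact: radius_le.
Qed.

Lemma read_code x : d b x <= D -> read (code x) = x.
Proof.
move=> bx; apply: mdist_eq0 => n; apply: (@ultra_lt _ (code x n)).
  by rewrite -decode_code // metric_sym readP.
by rewrite metric_sym codeP.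
Qed.

Lemma read_open (A : set X) z : open A -> A (read z) ->
  exists n, forall z', (forall i, (i <= n)%N -> z i = z' i) -> A (read z').
Proof.
rewrite openE => oA /oA /nbhs_ballP[r /= r0 rA].
have [n nr] := radius_small r0; exists n => z' zz'; apply: rA.
by rewrite ballEmdist /=; apply: lt_le_trans nr; exact: read_agree.
Qed.

End Coding.

(* The ball of centre [b] and radius [D] contains the whole part of the space
   which is not uniformly discrete at scale [e]. *)
Definition wide_ball (b : X) (D : R) :=
  e <= D /\ forall x, ~ eps_isolated e x -> d b x <= D.

Lemma reducible_of_moves (A B : set X) (a b b1 b2 : X) (Da Db : R)
    (F : (nat -> X) -> nat -> X) :
  wide_ball a Da -> wide_ball b Db ->
  d b b1 <= Db -> B b1 -> d b b2 <= Db -> ~ B b2 ->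
  (forall z z' n, (forall i, (i <= n)%N -> z i = z' i) -> F z n = F z' n) ->
  (forall z, A (read a Da z) <-> B (read b Db (F z))) ->
  reducible (@Lip R X) A B.
Proof.
move=> [eDa isoa] [eDb _] bb1 Bb1 bb2 nBb2 F_local FP.
pose f x := if d a x <= Da then read b Db (F (code a x))
            else if pselect (A x) then b1 else b2.
exists f; last first.
  apply/seteqP; split=> x; rewrite /f /=; case: ifP => ax.
  - by move=> Ax; apply/FP; rewrite read_code.
  - by case: pselect.
  - by move/FP; rewrite read_code.
  - by case: pselect.
have fb x : d b (f x) <= Db.
  rewrite /f; case: ifP => _; first exact: read_bounded.
  by case: pselect.
have Db0 : 0 < Db := lt_le_trans e_gt0 eDb.
have L0 : 0 <= Db / e by rewrite divr_ge0 // ltW.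
(* The term [Db / e] serves pairs at distance at least [e], whose images lie in a ball of radius
   [Db]. Distinct points closer than [e] are not isolated, so both are coded; if
   [radius n.+1 <= d x y < radius n], their codes agree up to [n] and the images are closer than
   [radius n], which is at most [2 * d x y]. *)
exists (2 + Db / e); first exact: addr_ge0.
move=> x y; rewrite mulrDl.
have xy0 : 0 <= d x y by exact: mdist_ge0.
have [exy|xye] := leP e (d x y).
  apply: (@le_trans _ _ Db).
    by apply: ultra_le (fb y); rewrite metric_sym.
  apply: (@le_trans _ _ (Db / e * d x y)); last by rewrite lerDr mulr_ge0.
  by rewrite mulrAC -mulrA ler_pMr // ler_pdivlMr // mul1r.
apply: (@le_trans _ _ (2 * d x y)); last by rewrite lerDl mulr_ge0.
have [->|xy] := eqVneq x y; first by rewrite !mdistxx mulr0.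
have inb u v : u != v -> d u v < e -> d a u <= Da.
  move=> uv uve; apply: isoa => /seteqP[/(_ v) H _].
  by move: uv; rewrite (H uve) eqxx.
rewrite /f (inb x y) // (inb y x); [|by rewrite eq_sym|by rewrite metric_sym].
have [n [nxy nP]] : exists n, radius n <= d x y /\
    forall m, (m < n)%N -> ~ radius m <= d x y.
  by apply: nat_least; apply: radius_small; rewrite mdist_gt0.
case: n nxy nP => [|n] nxy nP.
  by move: nxy; rewrite leNgt /radius divr1 xye.
have {}nP : d x y < radius n by rewrite ltNge; apply/negP/nP.
apply: ltW; apply: (@lt_le_trans _ _ (radius n)); last first.
  by rewrite radiusS ler_pM2l.
apply: read_agree => i ni; apply: F_local => j ji.
exact: (code_agree a nP (leq_trans ji ni)).
Qed.

Lemma unravelable_read (x0 a : X) (Da : R) (A : set X)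
    (m : (nat -> full_tree x0) -> nat -> X) :
  (forall x y n, play x -> play y -> x n = y n ->
    forall i, (i.*2.+1 < n)%N -> m x i = m y i) ->
  Borel A -> @unravelable (full_tree x0) [set x | A (read a Da (m x))].
Proof.
move=> m_local; move: A; apply: (@Borel_induction _ [set A |
  @unravelable (full_tree x0) [set x | A (read a Da (m x))]]) => /= [A oA|A|A].
- apply: open_unravelable => x px /= Ax.
  have [n nP] := read_open oA Ax; exists n.*2.+2 => y py yx; apply: nP => i ni.
  by apply: (m_local _ _ n.*2.+2) => //; lia.
- by move=> uA; exact: (unravelableC uA).
- by move=> uA; exact: (bigcup_unravelable uA).
Qed.

Lemma lipschitz_game (A B : set X) (a b b1 b2 : X) (Da Db : R) :
  Borel A -> Borel B -> wide_ball a Da -> wide_ball b Db ->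
  d b b1 <= Db -> B b1 -> d b b2 <= Db -> ~ B b2 ->
  reducible (@Lip R X) A B \/
  exists2 G : (nat -> X) -> nat -> X,
    forall v v' n, (forall i, (i < n)%N -> v i = v' i) -> G v n = G v' n &
    forall v, A (read a Da (G v)) <-> ~ B (read b Db v).
Proof.
move=> bA bB wa wb bb1 Bb1 bb2 nBb2.
pose Q z v := A (read a Da z) <-> ~ B (read b Db v).
have uQ : @unravelable (full_tree a) [set x | Q (movesI x) (movesII x)].
  have loc k (x y : nat -> full_tree a) n : (k <= 1)%N -> play x -> play y ->
      x n = y n -> forall i, (i.*2.+1 < n)%N ->
      move_at x (k + i.*2) = move_at y (k + i.*2).
    by move=> k1 px py xy i ni; apply: (move_at_agree px py xy); lia.
  have uA : @unravelable (full_tree a) [set x | A (read a Da (movesI x))].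
    apply: unravelable_read => // x y n px py xy i; exact: (@loc 0%N _ _ n).
  have uB : @unravelable (full_tree a) [set x | B (read b Db (movesII x))].
    apply: unravelable_read => // x y n px py xy i; exact: (@loc 1%N _ _ n).
  set SA := [set x | _] in uA; set SB := [set x | _] in uB.
  have -> : [set x | Q (movesI x) (movesII x)] =
      ~` (SA `|` ~` SB) `|` ~` (~` SA `|` SB).
    apply/seteqP; split=> x; rewrite /Q /SA /SB /=.
      by have [?|?] := pselect (A (read a Da (movesI x)));
        have [?|?] := pselect (B (read b Db (movesII x))); tauto.
    by have [?|?] := pselect (A (read a Da (movesI x)));
      have [?|?] := pselect (B (read b Db (movesII x))); tauto.
  by apply: unravelableU; apply: unravelableC; apply: unravelableU => //;
    exact: unravelableC.
have [[G [G_local GP]]|[F [F_local FP]]] := unravelable_moves uQ.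
  by right; exists G.
left; apply: (reducible_of_moves wa wb bb1 Bb1 bb2 nBb2 F_local) => z.
have := FP z; rewrite /Q.
by have [?|?] := pselect (A (read a Da z)); have [?|?] := pselect (B (read b Db (F z)));
  tauto.
Qed.

(* The Martin-Monk argument: composing the winning maps of the first player
   along [w] gives moves [monk_moves w n] for every game at once, and the
   membership of the point they code in [A 0] flips with each bit of [w]. *)
Section MartinMonk.
Variables (A : nat -> set X) (a : nat -> X) (D : nat -> R).
Variable G : nat -> bool -> (nat -> X) -> nat -> X.
Hypothesis BorelA : Borel (A 0%N).
Hypothesis G_local : forall n c v v' k,
  (forall i, (i < k)%N -> v i = v' i) -> G n c v k = G n c v' k.
Hypothesis G_winning : forall n c v, A n (read (a n) (D n) (G n c v)) <->
  if c then A n.+1 (read (a n.+1) (D n.+1) v)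
  else ~ A n.+1 (read (a n.+1) (D n.+1) v).

Fixpoint monk_approx (w : nat -> bool) k n : nat -> X :=
  if k is k'.+1 then G n (w n) (monk_approx w k' n.+1) else fun=> a n.

(** Move [k] of the first player depends only on strictly earlier moves of the opponent, so [k.+1]
    nested strategies determine it and the dummy moves [a n] do not matter. *)
Definition monk_moves w n k := monk_approx w k.+1 n k.

Lemma monk_approx_stable w k j n i : (i < k)%N -> (k <= j)%N ->
  monk_approx w j n i = monk_approx w k n i.
Proof.
elim: k j n i => // k IHk [//|j] n i ik kj /=; apply: G_local => l li.
by apply: IHk => //; exact: leq_trans li ik.
Qed.

Lemma monk_movesE w n : monk_moves w n = G n (w n) (monk_moves w n.+1).
Proof.
apply/funext => k; apply: G_local => i ik.
by apply: monk_approx_stable.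
Qed.

Lemma monk_approx_agree w w' k n :
  (forall i, (n <= i < n + k)%N -> w i = w' i) ->
  monk_approx w k n = monk_approx w' k n.
Proof.
elim: k n => //= k IHk n H; rewrite H; last by lia.
by rewrite IHk // => i ik; apply: H; lia.
Qed.

Lemma monk_moves_agree w w' n k :
  (forall i, (n <= i <= n + k)%N -> w i = w' i) ->
  monk_moves w n k = monk_moves w' n k.
Proof.
move=> H; rewrite /monk_moves (@monk_approx_agree w w') // => i ik.
by apply: H; lia.
Qed.

Let point w n := read (a n) (D n) (monk_moves w n).

Lemma monk_baire : baire_property [set w | A 0%N (point w 0%N)].
Proof.
move: BorelA; apply: (@Borel_induction _ [set B : set X |
  baire_property [set w | B (point w 0%N)]]) => /= [B oB|B|B].
- apply: open_baire_property => w /= Bw.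
  have [n nP] := read_open oB Bw; exists n.+1 => w' ww'; apply: nP => i ni.
  by apply: monk_moves_agree => j ji; apply: ww'; lia.
- by move=> bB; exact: (baire_propertyC bB).
- by move=> bB; exact: (baire_property_bigcup bB).
Qed.

(** Beyond the flipped bit [n] the moves coincide; at [n] the other game is used, which reverses
    membership; before [n] equal bits transmit the difference down to [A 0]. *)
Lemma martin_monk : False.
Proof.
apply: (no_flip_set monk_baire) => w w' n ww' fl.
suff H j m : (j + m)%N = n -> (A m (point w m) <-> ~ A m (point w' m)).
  by apply: (H n); rewrite addn0.
elim: j m => [|j IHj] m jm.
  rewrite add0n in jm; subst m.
  rewrite /point [monk_moves w n]monk_movesE [monk_moves w' n]monk_movesE.
  rewrite (_ : monk_moves w' n.+1 = monk_moves w n.+1); last first.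
    apply/funext => k; apply: monk_moves_agree => i ik; apply/esym/ww'; lia.
  have := G_winning n (w n) (monk_moves w n.+1).
  have := G_winning n (~~ w n) (monk_moves w n.+1).
  rewrite fl.
  by have [?|?] := pselect (A n.+1 (read (a n.+1) (D n.+1)
    (monk_moves w n.+1))); case: (w n) => /=; tauto.
have := IHj m.+1; rewrite addnS -addSn => /(_ jm).
rewrite /point [monk_moves w m]monk_movesE [monk_moves w' m]monk_movesE.
rewrite (ww' m); last by lia.
have := G_winning m (w' m) (monk_moves w m.+1).
have := G_winning m (w' m) (monk_moves w' m.+1).
case: (w' m); first tauto.
by have [?|?] := pselect (A m.+1 (read (a m.+1) (D m.+1) (monk_moves w m.+1)));
  have [?|?] := pselect (A m.+1 (read (a m.+1) (D m.+1) (monk_moves w' m.+1)));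
  tauto.
Qed.

End MartinMonk.

End LipschitzGame.

(** * Reducibility, the trivial degrees, and the theorem *)

Section Reducibility.
Variables (R : realType) (X : metricType R).
Implicit Types A B C : set X.

Local Notation "A <=L B" := (reducible (@Lip R X) A B) (at level 70).

Lemma Lip_id : Lip (@id X).
Proof. by exists 1 => // x y; rewrite mul1r. Qed.

Lemma Lip_cst (x : X) : Lip (fun _ : X => x).
Proof. by exists 0 => // y z; rewrite mdistxx mul0r. Qed.

Lemma reducible_trans A B C : A <=L B -> B <=L C -> A <=L C.
Proof.
move=> [f [L L0 fL] ->] [g [M M0 gM] ->]; exists (g \o f) => //.
exists (M * L); first exact: mulr_ge0.
move=> x y; apply: le_trans (gM _ _) _.
by rewrite -mulrA ler_wpM2l.
Qed.

Lemma reducibleC A B : A <=L B -> ~` A <=L ~` B.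
Proof. by move=> [f Lf ->]; exists f. Qed.

Lemma reducible0 B x : ~ B x -> set0 <=L B.
Proof.
by move=> nBx; exists (fun=> x); [exact: Lip_cst|apply/seteqP; split].
Qed.

Lemma reducibleT B x : B x -> setT <=L B.
Proof.
by move=> Bx; exists (fun=> x); [exact: Lip_cst|apply/seteqP; split].
Qed.

Lemma reducible_refl A : A <=L A.
Proof. by exists id; [exact: Lip_id|]. Qed.

Lemma trivial_or A : [\/ A = set0, A = setT | (exists x, A x) /\ exists x, ~ A x].
Proof.
have [[x Ax]|nA] := pselect (exists x, A x); last first.
  by constructor 1; apply/seteqP; split=> // x Ax; apply: nA; exists x.
have [nA|nA] := pselect (exists x, ~ A x).
  by constructor 3; split=> //; exists x.
constructor 2; apply/seteqP; split=> // y _.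
by apply: contrapT => nAy; apply: nA; exists y.
Qed.

(** Reductions obtained from the game need a point inside and a point outside the target set; the
    trivial cases are settled by constant maps and the identity. *)
Lemma trivial_semilinear A B : (B = set0 \/ B = setT) \/ (A = set0 \/ A = setT) ->
  A <=L B \/ ~` B <=L A.
Proof.
have [->|->|[[x Ax] [x' nAx']]] := trivial_or A;
  have [->|->|[[y By] [y' nBy']]] := trivial_or B => H.
- by left; exact: reducible_refl.
- by right; rewrite setCT; exact: reducible_refl.
- by left; exact: reducible0 nBy'.
- by right; rewrite setC0; exact: reducible_refl.
- by left; exact: reducible_refl.
- by left; exact: reducibleT By.
- by right; rewrite setC0; exact: reducibleT Ax.
- by right; rewrite setCT; exact: reducible0 nAx'.
- by case: H => -[] E; [move: By|case: nBy'|move: Ax|case: nAx']; rewrite E.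
Qed.

Lemma trivial_not_above A B : A = set0 \/ A = setT ->
  ~ strictly_reducible (@Lip R X) B A.
Proof.
move=> tA [[f Lf Bf] nAB]; apply: nAB.
suff -> : B = A by exact: reducible_refl.
by rewrite Bf; case: tA => ->; apply/seteqP; split.
Qed.

End Reducibility.

Theorem theorem3p17 (R : realType) (X : metricType R) :
  ultrametric_Polish X -> ~ nontrivially_unbounded X ->
  very_good (@Lip R X) (@Borel X).
Proof.
move=> [_ completeX ultraX] nU.
have [k [e [e0 ke]]] : exists (k : nat) (e : R), 0 < e /\
    forall x y : X, ~ eps_isolated e x -> ~ eps_isolated e y ->
      mdist x y <= k%:R.
  apply: contrapT => H; apply: nU => k e e0; apply: contrapT => nxy; apply: H.
  exists k, e; split=> // x y ix iy; rewrite leNgt; apply/negP => kxy.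
  by apply: nxy; exists x, y.
(* The point [b'] will lie on the other side of the set from [b]. The distance to one non-isolated
   point and the bound [k] cover all the others by the ultrametric inequality. *)
have wide (b b' : X) : exists D, wide_ball e b D /\ mdist b b' <= D.
  have [[x0 ix0]|nx] := pselect (exists x : X, ~ eps_isolated e x).
    exists (Num.max (Num.max e (mdist b b')) (Num.max (mdist b x0) k%:R)).
    split; last by rewrite !le_max lexx orbT.
    split=> [|x ix]; first by rewrite !le_max lexx.
    apply: le_trans (ultraX b x0 x) _; rewrite ge_max.
    by rewrite !le_max lexx (ke x0 x) // !orbT.
  exists (Num.max e (mdist b b')); split; last by rewrite le_max lexx orbT.
  split=> [|x ix]; first by rewrite le_max lexx.
  by exfalso; apply: nx; exists x.
have game := lipschitz_game ultraX completeX e0.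
split=> [A B bA bB|[A [bA sA]]].
  have [tA|tA|[[a Aa] [a' nAa']]] := trivial_or A.
  - by apply: trivial_semilinear; right; left.
  - by apply: trivial_semilinear; right; right.
  have [tB|tB|[[b Bb] [b' nBb']]] := trivial_or B.
  - by apply: trivial_semilinear; left; left.
  - by apply: trivial_semilinear; left; right.
  have [Da [wa aa']] := wide a a'; have [Db [wb bb']] := wide b b'.
  have b0 : mdist b b <= Db by rewrite mdistxx (le_trans _ bb') // mdist_ge0.
  have [AB|[G G_local GP]] := game A B a b b b' Da Db bA bB wa wb b0 Bb bb' nBb'.
    by left.
  right.
  have a0 : mdist a a <= Da by rewrite mdistxx (le_trans _ aa') // mdist_ge0.
  apply: (reducible_of_moves ultraX completeX e0 wb wa a0 Aa aa' nAa' (F := G)).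
    by move=> z z' n H; apply: G_local => i ni; apply: H; exact: ltnW.
  by move=> z /=; have := GP z; tauto.
have ntA n : (exists x, A n x) /\ exists x, ~ A n x.
  have [tA|tA|//] := trivial_or (A n).
    by case: (trivial_not_above (or_introl tA) (sA n)).
  by case: (trivial_not_above (or_intror tA) (sA n)).
have /choice[a aP] n : exists a, A n a := (ntA n).1.
have /choice[a' a'P] n : exists a, ~ A n a := (ntA n).2.
have /choice[D DP] n := wide (a n) (a' n).
have aa n : mdist (a n) (a n) <= D n.
  by rewrite mdistxx (le_trans _ (DP n).2) // mdist_ge0.
have nred n (c : bool) : ~ reducible (@Lip R X) (A n)
    (if c then ~` A n.+1 else A n.+1).
  (* A reduction of [A n] to the complement of [A n.+1] would reduce [A n.+1] to its complement,
     hence also the complement to [A n.+1], and so [A n] to [A n.+1]. *)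
  have [AS nA] := sA n; case: c => // AnC; apply: nA.
  apply: (reducible_trans AnC).
  by have := reducibleC (reducible_trans AS AnC); rewrite setCK.
have /choice[G GP] (nc : nat * bool) : exists G : (nat -> X) -> nat -> X,
    (forall v v' n, (forall i, (i < n)%N -> v i = v' i) -> G v n = G v' n) /\
    forall v, A nc.1 (read e (a nc.1) (D nc.1) (G v)) <->
      if nc.2 then A nc.1.+1 (read e (a nc.1.+1) (D nc.1.+1) v)
      else ~ A nc.1.+1 (read e (a nc.1.+1) (D nc.1.+1) v).
  case: nc => n c /=; have := @nred n c; case: c => nr.
    (* The bit [true] stands for the game against the complement, where winning means equal
       membership; the points inside and outside the target exchange roles. *)
    have bC : Borel (~` A n.+1).
      have [_ /(_ _ (bA n.+1)) + _] := smallest_sigma_algebra setT (@open X).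
      by rewrite setTD.
    have [//|[G G_local GP]] := game (A n) (~` A n.+1) (a n) (a n.+1)
      (a' n.+1) (a n.+1) (D n) (D n.+1) (bA n) bC (DP n).1 (DP n.+1).1
      (DP n.+1).2 (a'P n.+1) (aa n.+1) (fun H => H (aP n.+1)).
    exists G; split=> // v; have /= := GP v.
    by have [?|?] := pselect (A n.+1 (read e (a n.+1) (D n.+1) v)); tauto.
  have [//|[G G_local GP]] := game (A n) (A n.+1) (a n) (a n.+1)
      (a n.+1) (a' n.+1) (D n) (D n.+1) (bA n) (bA n.+1) (DP n).1 (DP n.+1).1
      (aa n.+1) (aP n.+1) (DP n.+1).2 (a'P n.+1).
  by exists G.
apply: (@martin_monk R X ultraX completeX e e0 A a D (fun n c => G (n, c))) => //.
- by move=> n c; exact: (GP (n, c)).1.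
- by move=> n c; exact: (GP (n, c)).2.
Qed.
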